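(* Let $f$ be as follows: $f(u,v,s)=\big(u,\ u^2f_{21}(u)+v^2+usf_{24}(u,s),\ u^2f_{31}(u)+v^2f_{32}(u,v,s)+usf_{34}(u,s)\big)$ with $f_{32}=c_0(u,s)+vc_1(u,s)+v^2c_2(u,v^2,s)+v^3c_3(u,v^2,s)$, $c_0(0,0)=0$, $c_3(0,0,0)\neq0$, and $c_1(u,s)=s+usd_1(s)+u^2d_2(s)+u^3d_3(s)+u^4d_4(u,s)$ with $d_2(0)>0$. For small $\tilde s\ne0$ let $s=-\tilde s^2$ and let $u(\tilde s)$ be the root of $c_1(u,-\tilde s^2)=0$ near $0$ with $u(\tilde s)\sim\tilde s/\sqrt{d_2(0)}$. Near $(u(\tilde s),0)$ let $u=u(v,s)$ be the smooth solution of $c_1(u,s)+v^2c_3(u,v^2,s)=0$ with $u(0,s)=u(\tilde s)$; then $v\mapsto\hat c(v)=f(u(v,s),v,s)$ is a self-intersection curve of $f(\cdot,\cdot,s)$ (as $f(u,v,s)=f(u,-v,s)$ along it). Let $\nu$ be the unit normal of the frontal $f(\cdot,\cdot,s)$ along $\hat c$, and for $v\ne0$ let $\kappa_g(v,\tilde s)=\det(\hat c',\hat c'',\nu)/|\hat c'|^3$ and $\kappa_n(v,\tilde s)=\hat c''\cdot\nu/|\hat c'|^2$ ($'=d/dv$), and let $\kappa_g(0,\tilde s),\kappa_n(0,\tilde s)$ denote their limits as $v\to0$ (taken from one side). Then $$\kappa_g(0,\tilde s)=\pm\frac{-2f_{21}(0)c_3(0,0,0)+(c_1)_{uu}(0,0)}{c_3(0,0,0)}+O_{\tilde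 s}(1),\qquad \kappa_n(0,\tilde s)=2f_{31}(0)+O_{\tilde s}(1),$$ where the sign depends on the side from which the limit is taken. In particular both curvatures are bounded for fixed $\tilde s\neq0$.
   Context: $O_{\tilde s}(n)$ denotes terms of degree at least $n$ in $\tilde s$. $f_{21},f_{31}$ are smooth in $u$; $f_{24},f_{34},c_0,c_1$ smooth in $(u,s)$; $c_2,c_3$ smooth in $(u,w,s)$; $d_1,d_2,d_3$ smooth in $s$ and $d_4$ smooth in $(u,s)$. For each $s$, $f(\cdot,\cdot,s)$ is a frontal (admits a smooth unit normal field $\nu$ orthogonal to $f_u,f_v$). *)

(* Defs.v *)
From HB Require Import structures.
From mathcomp Require Import all_boot all_order all_algebra.
From mathcomp Require Import all_classical all_reals all_analysis.
Set Implicit Arguments. Unset Strict Implicit. Unset Printing Implicit Defensive.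
Import Order.TTheory GRing.Theory Num.Theory.
Import numFieldNormedType.Exports.
Local Open Scope ring_scope.
Local Open Scope classical_set_scope.

Section Defs.
Variable R : realType.

Fixpoint Ck (n k : nat) (F : 'rV[R]_n -> R) : Prop :=
  continuous F /\
  match k with
  | 0 => True
  | k'.+1 => forall i : 'I_n,
      (forall x, derivable F x (delta_mx 0 i)) /\
      Ck k' (fun x => 'D_(delta_mx 0 i) F x)
  end.

Definition smooth_fun (n : nat) (F : 'rV[R]_n -> R) := forall k, Ck k F.

Definition smooth1 (g : R -> R) :=
  smooth_fun (fun x : 'rV[R]_1 => g (x ord0 ord0)).
Definition smooth2 (g : R -> R -> R) :=
  smooth_fun (fun x : 'rV[R]_2 => g (x ord0 (inord 0)) (x ord0 (inord 1))).
Definition smooth3 (g : R -> R -> R -> R) :=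
  smooth_fun (fun x : 'rV[R]_3 =>
    g (x ord0 (inord 0)) (x ord0 (inord 1)) (x ord0 (inord 2))).

Definition smooth_on_sym (g : R -> R) (eta : R) :=
  forall (k : nat) (x : R), - eta < x < eta -> derivable (iter k (@derive1 R R) g) x 1.

Definition vec3 (a b c : R) : 'rV[R]_3 := \row_(i < 3) [:: a; b; c]`_i.
Definition cmp (x : 'rV[R]_3) (i : nat) : R := x ord0 (inord i).
Definition dot3 (x y : 'rV[R]_3) : R := \sum_(i < 3) x ord0 i * y ord0 i.
Definition enorm3 (x : 'rV[R]_3) : R := Num.sqrt (dot3 x x).
Definition cross3 (x y : 'rV[R]_3) : 'rV[R]_3 :=
  vec3 (cmp x 1 * cmp y 2 - cmp x 2 * cmp y 1)
       (cmp x 2 * cmp y 0 - cmp x 0 * cmp y 2)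
       (cmp x 0 * cmp y 1 - cmp x 1 * cmp y 0).
Definition det3 (x y z : 'rV[R]_3) : R :=
  \det (\matrix_(i < 3, j < 3) ([:: x; y; z]`_i) ord0 j).

Definition f32 (c0 c1 : R -> R -> R) (c2 c3 : R -> R -> R -> R) (u v s : R) : R :=
  c0 u s + v * c1 u s + v ^+ 2 * c2 u (v ^+ 2) s + v ^+ 3 * c3 u (v ^+ 2) s.

Definition surf_f (f21 f31 : R -> R) (f24 f34 c0 c1 : R -> R -> R)
  (c2 c3 : R -> R -> R -> R) (u v s : R) : 'rV[R]_3 :=
  vec3 u
       (u ^+ 2 * f21 u + v ^+ 2 + u * s * f24 u s)
       (u ^+ 2 * f31 u + v ^+ 2 * f32 c0 c1 c2 c3 u v s + u * s * f34 u s).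

(* unit normal of the frontal f(.,.,s): normalisation of f_u x (f_v / v),
   (for v <> 0; f_v / v extends smoothly to v = 0). *)
Definition unit_normal (F : R -> R -> R -> 'rV[R]_3) (u v s : R) : 'rV[R]_3 :=
  let fu := derive1 (fun x => F x v s) u in
  let fv := derive1 (fun y => F u y s) v in
  let n := cross3 fu (v^-1 *: fv) in
  (enorm3 n)^-1 *: n.

Definition kappa_g (F : R -> R -> R -> 'rV[R]_3) (Uv : R -> R) (s v : R) : R :=
  let c := fun y => F (Uv y) y s in
  det3 (derive1 c v) (derive1 (derive1 c) v) (unit_normal F (Uv v) v s)
    / enorm3 (derive1 c v) ^+ 3.

Definition kappa_n (F : R -> R -> R -> 'rV[R]_3) (Uv : R -> R) (s v : R) : R :=
  let c := fun y => F (Uv y) y s in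
  dot3 (derive1 (derive1 c) v) (unit_normal F (Uv v) v s)
    / enorm3 (derive1 c v) ^+ 2.

End Defs.

(* Main.v *)
Require Import Defs.
From HB Require Import structures.
From mathcomp Require Import all_boot all_order all_algebra.
From mathcomp Require Import all_classical all_reals all_analysis.
From mathcomp Require Import ring lra.
Import Order.TTheory GRing.Theory Num.Theory.
Import numFieldNormedType.Exports.
Local Open Scope ring_scope.
Local Open Scope classical_set_scope.

(* Fix [s = - t ^+ 2] and write [w = v ^+ 2].  The equation [c1 + w c3 = 0] can be
   solved for [w] as a function of [u], so the self-intersection curve can be
   parametrised by [u] instead of [v]: in this parameter it is regular, with first
   two derivatives [T = (1, tan2, tan3)] and [E = (0, acc2, acc3)], while in the
   parameter [v] its derivative [U' T] vanishes at [v = 0].  Because [T] is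
   orthogonal to the normal [n], this gives
     [kappa_g = sg U' * det (T, E, n) / (|n| |T| ^ 3)],
     [kappa_n = E . n / (|n| |T| ^ 2)],
   where [T], [E], [n] are explicit functions of [(u, v, s)] and the sign of [U']
   changes at [v = 0].  Both quotients are Lipschitz near the origin.  Hence the
   one-sided limits are their values at [(us t, 0, - t ^+ 2)], which is within
   [O(t)] of the origin, and it remains to evaluate them at the origin. *)

(** * Mean value theorem and chain rule for functions of several variables *)

Section Multivariate.
Set Implicit Arguments. Unset Strict Implicit.
Variable R : realType.

(** No order is imposed on [a] and [b], because coordinate increments have either sign. Controlling
    the distance from [c] to [a] is what later keeps the intermediate points close to the starting
    point. *)
Lemma mean_value (f df : R -> R) (a b : R) :
  (forall x : R, is_derive x 1 f (df x)) ->
  exists2 c, `|c - a| <= `|b - a| & f b - f a = (b - a) * df c.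
Proof.
move=> fdf.
have cf : continuous f.
  by move=> x; apply/differentiable_continuous/derivable1_diffP.
have wf x y : {within `[x, y], continuous f} by apply: continuous_subspaceT.
have [ab|/ltW ba] := leP a b.
  have [c] := @MVT_segment _ f df a b ab (fun x _ => fdf x) (wf _ _).
  rewrite in_itv/= => /andP[ac cb] ->; exists c; last by rewrite mulrC.
  by rewrite !ger0_norm ?subr_ge0 ?lerD2r.
have [c] := @MVT_segment _ f df b a ba (fun x _ => fdf x) (wf _ _).
rewrite in_itv/= => /andP[bc ca] e; exists c.
  by rewrite !ler0_norm ?subr_le0 ?lerN2 ?lerD2r.
by rewrite -opprB e -mulrN opprB mulrC.
Qed.

Lemma is_derive_line (n : nat) (F : 'rV[R]_n -> R) (x v : 'rV[R]_n) (a : R) :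
  derivable F (x + a *: v) v ->
  is_derive a 1 (fun h => F (x + h *: v)) ('D_v F (x + a *: v)).
Proof.
move=> dF.
have E : (fun h => h^-1 *: (F (x + (h *: 1 + a) *: v) - F (x + a *: v))) =
    (fun h => h^-1 *: (F (h *: v + (x + a *: v)) - F (x + a *: v))).
  apply/funext => h; congr (_ *: (F _ - _)).
  by rewrite [h *: 1]mulr1 scalerDl addrCA.
split; first by rewrite /derivable /= E.
by rewrite /derive /= E.
Qed.

Lemma rV_norm_le (n : nat) (x : 'rV[R]_n) (C : R) :
  0 <= C -> (forall i, `|x 0 i| <= C) -> `|x| <= C.
Proof.
move=> C0 xC; rewrite [leLHS]/Num.Def.normr/= mx_normrE.
by apply: bigmax_le => // -[i j] _; rewrite (ord1 i).
Qed.

Lemma coord_norm_le (n : nat) (x : 'rV[R]_n) i : `|x 0 i| <= `|x|.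
Proof.
rewrite [leRHS]/Num.Def.normr/= mx_normrE.
exact: (le_bigmax _ (fun ij => `|x ij.1 ij.2|) (0, i)).
Qed.

(* [y] is reached from [x] by changing the coordinates one after the other. *)
Lemma mean_value_coords (n : nat) (F : 'rV[R]_n -> R) (x y : 'rV[R]_n) :
  (forall i z, derivable F z (delta_mx 0 i)) ->
  exists2 xi : 'I_n -> 'rV[R]_n, (forall i, `|xi i - x| <= `|y - x|) &
    F y - F x = \sum_i (y 0 i - x 0 i) * 'D_(delta_mx 0 i) F (xi i).
Proof.
move=> dF.
pose z k : 'rV[R]_n := \row_j (if (j < k)%N then y 0 j else x 0 j).
have step (i : 'I_n) : exists2 w : 'rV[R]_n, `|w - x| <= `|y - x| &
    F (z i.+1) - F (z i) = (y 0 i - x 0 i) * 'D_(delta_mx 0 i) F w.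
  have dG (a : R) : is_derive a 1 (fun h => F (z i + h *: delta_mx 0 i))
      ('D_(delta_mx 0 i) F (z i + a *: delta_mx 0 i)).
    exact: is_derive_line.
  have [c] := @mean_value _ _ 0 (y 0 i - x 0 i) dG.
  rewrite !subr0 scale0r addr0 => hc E.
  exists (z i + c *: delta_mx 0 i).
    (* In the sup norm it suffices to compare coordinates: the difference to [x] is that of [y]
       before [i], is bounded by [hc] at [i], and is zero after [i]. *)
    apply: rV_norm_le => // j; rewrite !mxE eqxx /=.
    have [->|ji] := eqVneq j i.
      rewrite ltnn mulr1 addrAC subrr add0r (le_trans hc)//.
      by have := coord_norm_le (y - x) i; rewrite !mxE.
    rewrite mulr0 addr0; case: ifP => _; last by rewrite subrr normr0.
    by have := coord_norm_le (y - x) j; rewrite !mxE.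
  rewrite -E; congr (F _ - _); apply/rowP => j; rewrite !mxE eqxx/= ltnS leq_eqVlt.
  have [->|ji] := eqVneq j i; first by rewrite eqxx ltnn/= mulr1 addrC subrK.
  by rewrite mulr0 addr0 -(inj_eq val_inj) in ji *; rewrite (negbTE ji).
have [xi /all_and2[xi1 xi2]] := choice (fun i => let: ex_intro2 w a b := step i in
   ex_intro (fun w => _ /\ _) w (conj a b)).
exists xi => //.
have zn : z n = y by apply/rowP => j; rewrite mxE ltn_ord.
have z0 : z 0 = x by apply/rowP => j; rewrite mxE.
rewrite -{1}zn -{1}z0 -(telescope_sumr (fun k => F (z k)))// big_mkord.
by apply: eq_bigr => i _.
Qed.

Lemma continuous_rV (T : topologicalType) (n : nat) (X : 'I_n -> T -> R) (v : T) :
  (forall i, {for v, continuous (X i)}) ->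
  {for v, continuous (fun x => \row_i X i x : 'rV[R]_n)}.
Proof.
move=> Xc; apply/cvgrPdist_le => /= e e0; near=> x.
apply: rV_norm_le; first exact: ltW.
move=> i; rewrite !mxE; move: i; near: x; apply: filter_forall => i.
by move: (Xc i) => /cvgrPdist_le; apply.
Unshelve. all: by end_near. Qed.

Lemma cvg_sumr (T : Type) (F : set_system T) (n : nat) (f : 'I_n -> T -> R)
    (l : 'I_n -> R) : Filter F ->
  (forall i, f i x @[x --> F] --> l i) ->
  \sum_i f i x @[x --> F] --> \sum_i l i.
Proof.
move=> FF; elim: n f l => [|n IH] f l fl.
  under eq_fun do rewrite big_ord0.
  by rewrite big_ord0; exact: cvg_cst.
under eq_fun do rewrite big_ord_recl.
by rewrite big_ord_recl; apply: cvgD; [exact: fl|apply: IH].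
Qed.

(** The coordinatewise mean value theorem turns the difference quotient into a sum of quotients of
    the [X i] times partial derivatives of [F] at intermediate points. These points tend to the base
    point, so continuity of the first partial derivatives is enough. *)
Lemma chain_rule (n : nat) (F : 'rV[R]_n -> R) (X : 'I_n -> R -> R) (v : R)
    (dX : 'I_n -> R) :
  Ck 1 F -> (forall i, is_derive v 1 (X i) (dX i)) ->
  is_derive v 1 (fun x => F (\row_i X i x))
    (\sum_i dX i * 'D_(delta_mx 0 i) F (\row_i X i v)).
Proof.
move=> [_ CF] dXi.
pose Y x : 'rV[R]_n := \row_i X i x.
have dF i z : derivable F z (delta_mx 0 i) by exact: (CF i).1.
have cD i : continuous (fun z => 'D_(delta_mx 0 i) F z) by have [_ []] := CF i.
have [xi /all_and2[xi1 xi2]] := choice (fun h =>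
  let: ex_intro2 w a b := mean_value_coords (Y v) (Y (h + v)) dF in
   ex_intro (fun w => _ /\ _) w (conj a b)).
have cY : {for v, continuous Y}.
  by apply: continuous_rV => i; apply/differentiable_continuous/derivable1_diffP.
have cYs : Y (h + v) @[h --> 0] --> Y v.
  have : (h + v) @[h --> (0 : R)] --> v.
    rewrite -[X in _ --> X]add0r; apply: cvgD; [exact: cvg_id|exact: cvg_cst].
  by move=> /cvg_comp; apply.
have cxi i : xi h i @[h --> 0^'] --> Y v.
  apply/cvgrPdist_le => /= e e0.
  move/cvgrPdist_le : cYs => /(_ _ e0) Ye.
  near=> h; rewrite distrC (le_trans (xi1 _ _))// distrC.
  by near: h; exact: (nbhs_dnbhs Ye).
suff H : h^-1 *: (F (Y (h *: 1 + v)) - F (Y v)) @[h --> 0^'] -->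
    \sum_i dX i * 'D_(delta_mx 0 i) F (Y v).
  split; first by apply/cvg_ex; eexists; exact: H.
  by apply/cvg_lim => //; exact: H.
have -> : (fun h => h^-1 *: (F (Y (h *: 1 + v)) - F (Y v))) = (fun h =>
    \sum_i (h^-1 *: (X i (h *: 1 + v) - X i v)) * 'D_(delta_mx 0 i) F (xi h i)).
  apply/funext => h; rewrite [h *: 1]mulr1 xi2 scaler_sumr; apply: eq_bigr => i _.
  by rewrite !mxE scalerAl.
apply: cvg_sumr => i; apply: cvgM.
  by have [d e] := dXi i; rewrite -e; exact: d.
exact: cvg_comp (cxi i) (cD i (Y v)).
Unshelve. all: by end_near. Qed.

End Multivariate.

(** * Calculus of functions that are Lipschitz near a point *)

Lemma near_ball (R : realType) (V : normedModType R) (p : V) (P : V -> Prop) : (\forall x \near p, P x) ->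
  \forall d \near (0 : R)^'+, forall x, ball p d x -> P x.
Proof.
move=> /nbhs_ballP[e /= e0 eP]; near=> d => x xd; apply: eP.
by apply: le_ball xd; near: d; exact: nbhs_right_le.
Unshelve. all: by end_near. Qed.

Section LocallyLipschitz.
Set Implicit Arguments. Unset Strict Implicit.
Variables (R : realType) (V : normedModType R) (p : V).
Implicit Types G H : V -> R.

(** The estimate is asked for all small radii rather than for one, so that several such estimates
    can be combined with [near] without choosing a minimum of radii. *)
Definition loclip G := exists C : R, \forall d \near 0^'+,
  forall x y, ball p d x -> ball p d y -> `|G x - G y| <= C * `|x - y|.

Lemma loclip_pos G : loclip G -> exists2 C : R, 0 <= C & \forall d \near 0^'+,
  forall x y, ball p d x -> ball p d y -> `|G x - G y| <= C * `|x - y|.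
Proof.
move=> [C CG]; exists `|C| => //; apply: filterS CG => d dC x y xd yd.
by rewrite (le_trans (dC _ _ xd yd))// ler_wpM2r// ler_norm.
Qed.

Lemma loclip_cst (c : R) : loclip (fun=> c).
Proof. by exists 0; near=> d => x y _ _; rewrite subrr normr0 mul0r.
Unshelve. all: by end_near. Qed.

Lemma loclipD G H : loclip G -> loclip H -> loclip (fun x => G x + H x).
Proof.
move=> [C CG] [D DH]; exists (C + D); near=> d => x y xd yd.
rewrite opprD addrACA mulrDl (le_trans (ler_normD _ _))// lerD//.
- by move: x y xd yd; near: d.
- by move: x y xd yd; near: d.
Unshelve. all: by end_near. Qed.

Lemma loclipN G : loclip G -> loclip (fun x => - G x).
Proof.
move=> [C CG]; exists C; apply: filterS CG => d H x y xd yd.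
by rewrite -opprD normrN H.
Qed.

(** Continuity is obtained at every point close to [p], not only at [p]: the limits in [v] are taken
    at points which merely tend to the origin. *)
Lemma loclip_continuous G : loclip G ->
  \forall x \near p, {for x, continuous G}.
Proof.
move=> /loclip_pos[C C0 CG].
have [d d0 Cd] : exists2 d, 0 < d & forall x y, ball p d x -> ball p d y ->
    `|G x - G y| <= C * `|x - y|.
  near (0 : R)^'+ => d; exists d; last by near: d.
  by near: d; exact: nbhs_right_gt.
apply/nbhs_ballP; exists d => // x xd; apply/cvgrPdist_le => /= e e0.
(* [C] may be zero, so the division below uses [C + 1]. *)
have C1 : 0 < C + 1 by rewrite ltr_wpDl.
near=> y; rewrite (le_trans (Cd _ _ xd _))//.
  near: y; apply: open_nbhs_nbhs; split => //; exact: ball_open.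
rewrite (@le_trans _ _ ((C + 1) * `|x - y|))// ?ler_wpM2r ?lerDl//.
rewrite -ler_pdivlMl//; near: y.
have := @cvg_id _ (nbhs x); move/cvgrPdist_le; apply.
by rewrite mulr_gt0// invr_gt0.
Unshelve. all: by end_near. Qed.

Lemma loclip_continuous_at G : loclip G -> {for p, continuous G}.
Proof. by move=> /loclip_continuous/nbhs_singleton. Qed.

Lemma loclip_bound G : loclip G -> exists2 B : R, 0 <= B &
  \forall d \near (0 : R)^'+, forall x, ball p d x -> `|G x| <= B.
Proof.
move=> /loclip_continuous_at Gp; exists (`|G p| + 1); first exact: addr_ge0.
apply: near_ball; move/cvgrPdist_le : Gp => /(_ _ ltr01); apply: filterS => x.
rewrite distrC -lerBlDl; apply: le_trans.
by rewrite lerBlDl -{1}(subrK (G p) (G x)) addrC ler_normD.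
Qed.

Lemma loclipM G H : loclip G -> loclip H -> loclip (fun x => G x * H x).
Proof.
move=> lG lH.
have [C C0 CG] := loclip_pos lG; have [D D0 DH] := loclip_pos lH.
have [B B0 BG] := loclip_bound lG; have [E E0 EH] := loclip_bound lH.
exists (B * D + C * E); near=> d => x y xd yd.
have -> : G x * H x - G y * H y = G x * (H x - H y) + (G x - G y) * H y by ring.
rewrite [leRHS]mulrDl (le_trans (ler_normD _ _))// !normrM lerD//.
- rewrite -mulrA ler_pM//; [by move: x xd {yd}; near: d|].
  by move: x y xd yd; near: d.
- rewrite mulrAC ler_pM//; [by move: x y xd yd; near: d|].
  by move: y yd; near: d.
Unshelve. all: by end_near. Qed.

Lemma loclipX G n : loclip G -> loclip (fun x => G x ^+ n).
Proof.
move=> lG; elim: n => [|n IH]; first exact: loclip_cst.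
by under eq_fun do rewrite exprS; exact: loclipM.
Qed.

Lemma loclipV G : loclip G -> G p != 0 -> loclip (fun x => (G x)^-1).
Proof.
move=> lG Gp0; have [C C0 CG] := loclip_pos lG.
have Gpp : 0 < `|G p| by rewrite normr_gt0.
pose m := `|G p| / 2.
have m0 : 0 < m by rewrite divr_gt0.
have mG : \forall d \near (0 : R)^'+, forall x, ball p d x -> m <= `|G x|.
  apply: near_ball; have /cvgrPdist_le/(_ _ m0) := loclip_continuous_at lG.
  apply: filterS => x; have := ler_normD (G p - G x) (G x).
  by rewrite subrK /m; lra.
(* Near [p] both values are at least [m] in absolute value, so their product is at least
   [m ^+ 2]. *)
exists (C / m ^+ 2); near=> d => x y xd yd.
have mx : m <= `|G x| by move: x xd {yd}; near: d.
have my : m <= `|G y| by move: y yd; near: d.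
have x0 : G x != 0 by rewrite -normr_gt0 (lt_le_trans m0).
have y0 : G y != 0 by rewrite -normr_gt0 (lt_le_trans m0).
have -> : (G x)^-1 - (G y)^-1 = (G y - G x) * (G x * G y)^-1.
  by field; rewrite ?x0 ?y0.
rewrite normrM mulrAC ler_pM//.
  by rewrite distrC; move: x y xd yd {mx my x0 y0}; near: d.
rewrite normfV normrM lef_pV2 ?posrE ?exprn_gt0 ?mulr_gt0 ?normr_gt0//.
by rewrite expr2 ler_pM// ltW.
Unshelve. all: by end_near. Qed.

(** Multiplying by the conjugate gives a quotient by a sum of two square roots, each of which is
    bounded below by [Num.sqrt m] because [G p] is positive. *)
Lemma loclip_sqrt G : loclip G -> 0 < G p -> loclip (fun x => Num.sqrt (G x)).
Proof.
move=> lG Gp0; have [C C0 CG] := loclip_pos lG.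
pose m := G p / 2.
have m0 : 0 < m by rewrite divr_gt0.
have mG : \forall d \near (0 : R)^'+, forall x, ball p d x -> m <= G x.
  apply: near_ball; have /cvgrPdist_le/(_ _ m0) := loclip_continuous_at lG.
  apply: filterS => x; have := ler_norm (G p - G x).
  by rewrite /m; lra.
exists (C / Num.sqrt m); near=> d => x y xd yd.
have mx : m <= G x by move: x xd {yd}; near: d.
have my : m <= G y by move: y yd; near: d.
have x0 : 0 < G x by apply: lt_le_trans mx.
have y0 : 0 < G y by apply: lt_le_trans my.
have sx : 0 < Num.sqrt (G x) by rewrite sqrtr_gt0.
have sy : 0 < Num.sqrt (G y) by rewrite sqrtr_gt0.
have s0 : 0 < Num.sqrt (G x) + Num.sqrt (G y) by rewrite addr_gt0.
have -> : Num.sqrt (G x) - Num.sqrt (G y) =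
    (G x - G y) / (Num.sqrt (G x) + Num.sqrt (G y)).
  rewrite -{2}(sqr_sqrtr (ltW x0)) -{2}(sqr_sqrtr (ltW y0)).
  by field; rewrite gt_eqF.
rewrite normrM mulrAC ler_pM//.
  by move: x y xd yd {mx my x0 y0 sx sy s0}; near: d.
rewrite normfV lef_pV2 ?posrE ?normr_gt0 ?gt_eqF ?sqrtr_gt0//.
by rewrite gtr0_norm// ler_wpDr ?(ltW sy)// ler_sqrt// ltW.
Unshelve. all: by end_near. Qed.

(** Continuous partial derivatives are bounded near the image of [p]; the coordinatewise mean value
    theorem then gives the constant. *)
Lemma loclip_Ck (n : nat) (F : 'rV[R]_n -> R) (X : 'I_n -> V -> R) :
  Ck 1 F -> (forall i, loclip (X i)) -> loclip (fun x => F (\row_i X i x)).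
Proof.
move=> [_ CF] lX.
have dF i z : derivable F z (delta_mx 0 i) by exact: (CF i).1.
have cD i : continuous (fun z => 'D_(delta_mx 0 i) F z) by have [_ []] := CF i.
pose Y x : 'rV[R]_n := \row_i X i x.
have cY : {for p, continuous Y}.
  by apply: continuous_rV => i; exact: loclip_continuous_at.
have [C /all_and2[C0 CX]] := choice (fun i =>
  let: ex_intro2 w a b := loclip_pos (lX i) in
  ex_intro (fun w => 0 <= w /\ _) w (conj a b)).
pose B i := `|'D_(delta_mx 0 i) F (Y p)| + 1.
have [e e0 Be] : exists2 e : R, 0 < e & forall i z, ball (Y p) e z ->
    `|'D_(delta_mx 0 i) F z| <= B i.
  near (0 : R)^'+ => e; exists e.
    by near: e; exact: nbhs_right_gt.
  near: e; apply: filter_forall => i; apply: near_ball.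
  have /cvgrPdist_le/(_ _ ltr01) := cD i (Y p); apply: filterS => z.
  rewrite distrC /B -lerBlDl; apply: le_trans.
  rewrite lerBlDl -{1}(subrK ('D_(delta_mx 0 i) F (Y p)) ('D_(delta_mx 0 i) F z)).
  by rewrite addrC ler_normD.
(* The intermediate points lie within [2 * e / 3] of [Y y], which is itself within [e / 3] of [Y p];
   so they stay in the ball where the bounds [B i] hold. *)
have e3 : 0 < e / 3 by rewrite divr_gt0.
exists (\sum_i C i * B i); near=> d => x y xd yd.
have Yx : `|Y p - Y x| < e / 3.
  move: x xd {yd}; near: d; apply: near_ball.
  by have /cvgrPdist_lt/(_ _ e3) := cY.
have Yy : `|Y p - Y y| < e / 3.
  move: y yd; near: d; apply: near_ball.
  by have /cvgrPdist_lt/(_ _ e3) := cY.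
have [xi xi1 ->] := mean_value_coords (Y y) (Y x) dF.
rewrite mulr_suml (le_trans (ler_norm_sum _ _ _))// ler_sum// => i _.
rewrite normrM mulrAC ler_pM//.
  rewrite !mxE; move: i x y xd yd {Yx Yy xi xi1}; near: d.
  by apply: filter_forall => i; exact: CX.
apply: Be; rewrite -ball_normE /=.
have := xi1 i; have := ler_normD (Y p - Y y) (Y y - xi i).
have := ler_normD (Y x - Y p) (Y p - Y y).
rewrite addrA subrK addrA subrK (distrC (Y y)) (distrC (Y x) (Y p)); lra.
Unshelve. all: by end_near. Qed.
End LocallyLipschitz.

(** * Partial derivatives of smooth functions written in curried form *)

Section Curried.
Set Implicit Arguments. Unset Strict Implicit.
Variable R : realType.

Definition row1 (u : R) : 'rV[R]_1 := \row_(i < 1) [:: u]`_i.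
Definition row2 (u s : R) : 'rV[R]_2 := \row_(i < 2) [:: u; s]`_i.

(** Partial derivatives are returned in curried form, so that smoothness applies to them again and
    they can be iterated. [pd2] differentiates in the first variable only, as [s] is a fixed
    parameter throughout. *)
Definition pd1 (g : R -> R) (u : R) : R :=
  'D_(delta_mx 0 ord0) (fun x : 'rV[R]_1 => g (x ord0 ord0)) (row1 u).
Definition pd2 (g : R -> R -> R) (u s : R) : R :=
  'D_(delta_mx 0 (inord 0))
    (fun x : 'rV[R]_2 => g (x ord0 (inord 0)) (x ord0 (inord 1))) (row2 u s).
Definition pd3 (j : nat) (g : R -> R -> R -> R) (u w s : R) : R :=
  'D_(delta_mx 0 (inord j)) (fun x : 'rV[R]_3 =>
    g (x ord0 (inord 0)) (x ord0 (inord 1)) (x ord0 (inord 2))) (vec3 u w s).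

Lemma smooth_fun_partial (n : nat) (F : 'rV[R]_n -> R) i :
  smooth_fun F -> smooth_fun (fun x => 'D_(delta_mx 0 i) F x).
Proof. by move=> sF k; have [_ /(_ i)[]] := sF k.+1. Qed.

Lemma row1_eta (x : 'rV[R]_1) : row1 (x ord0 ord0) = x.
Proof. by apply/rowP => i; rewrite mxE (ord1 i). Qed.

Lemma row2_eta (x : 'rV[R]_2) : row2 (x ord0 (inord 0)) (x ord0 (inord 1)) = x.
Proof.
apply/rowP => -[[|[|//]] i]; rewrite mxE /=; congr (x _ _);
  by apply/val_inj; rewrite /= inordK.
Qed.

Lemma vec3_eta (x : 'rV[R]_3) :
  vec3 (x ord0 (inord 0)) (x ord0 (inord 1)) (x ord0 (inord 2)) = x.
Proof.
apply/rowP => -[[|[|[|//]]] i]; rewrite mxE /=; congr (x _ _);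
  by apply/val_inj; rewrite /= inordK.
Qed.

Lemma smooth1_pd g : smooth1 g -> smooth1 (pd1 g).
Proof.
move=> /(smooth_fun_partial ord0); congr smooth_fun.
by apply/funext => x; rewrite /pd1 row1_eta.
Qed.

Lemma smooth2_pd g : smooth2 g -> smooth2 (pd2 g).
Proof.
move=> /(smooth_fun_partial (inord 0)); congr smooth_fun.
by apply/funext => x; rewrite /pd2 row2_eta.
Qed.

Lemma smooth3_pd j g : smooth3 g -> smooth3 (pd3 j g).
Proof.
move=> /(smooth_fun_partial (inord j)); congr smooth_fun.
by apply/funext => x; rewrite /pd3 vec3_eta.
Qed.

Lemma smooth1_chain g (a : R -> R) (v da : R) : smooth1 g ->
  is_derive v 1 a da -> is_derive v 1 (fun x => g (a x)) (da * pd1 g (a v)).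
Proof.
move=> sg dA.
have := @chain_rule R 1 _ (fun i x => [:: a x]`_i) v (fun i => [:: da]`_i) (sg 1%N).
rewrite big_ord_recl big_ord0 addr0 /=.
under [X in is_derive v 1 X]funext => x do rewrite mxE /=.
by apply; case=> -[|//] i.
Qed.

Lemma smooth2_chain g (a : R -> R) (s v da : R) : smooth2 g ->
  is_derive v 1 a da ->
  is_derive v 1 (fun x => g (a x) s) (da * pd2 g (a v) s).
Proof.
move=> sg dA.
have := @chain_rule R 2 _ (fun i x => [:: a x; s]`_i) v (fun i => [:: da; 0]`_i)
  (sg 1%N).
rewrite !big_ord_recl big_ord0 addr0 /= mul0r addr0.
under [X in is_derive v 1 X]funext => x do rewrite !mxE !inordK//=.
rewrite (_ : ord0 = inord 0 :> 'I_2); last by apply/val_inj; rewrite /= inordK.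
by apply; case=> -[|[|//]] i //=; exact: is_derive_cst.
Qed.

Lemma smooth3_chain g (a b : R -> R) (s v da db : R) : smooth3 g ->
  is_derive v 1 a da -> is_derive v 1 b db ->
  is_derive v 1 (fun x => g (a x) (b x) s)
    (da * pd3 0 g (a v) (b v) s + db * pd3 1 g (a v) (b v) s).
Proof.
move=> sg dA dB.
have := @chain_rule R 3 _ (fun i x => [:: a x; b x; s]`_i) v
  (fun i => [:: da; db; 0]`_i) (sg 1%N).
rewrite !big_ord_recl big_ord0 addr0 /= mul0r addr0.
under [X in is_derive v 1 X]funext => x do rewrite !mxE !inordK//=.
rewrite (_ : ord0 = inord 0 :> 'I_3); last by apply/val_inj; rewrite /= inordK.
rewrite (_ : lift _ _ = inord 1); last by apply/val_inj; rewrite /= !inordK.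
by apply; case=> -[|[|[|//]]] i //=; exact: is_derive_cst.
Qed.

Variables (V : normedModType R) (p : V).

Lemma loclip_smooth1 g (a : V -> R) : smooth1 g -> loclip p a ->
  loclip p (fun x => g (a x)).
Proof.
move=> sg la; have := @loclip_Ck R V p 1 _ (fun i x => [:: a x]`_i) (sg 1%N).
under [X in loclip _ X]funext => x do rewrite mxE /=.
by apply; case=> -[|//] i.
Qed.

Lemma loclip_smooth2 g (a b : V -> R) : smooth2 g -> loclip p a -> loclip p b ->
  loclip p (fun x => g (a x) (b x)).
Proof.
move=> sg la lb.
have := @loclip_Ck R V p 2 _ (fun i x => [:: a x; b x]`_i) (sg 1%N).
under [X in loclip _ X]funext => x do rewrite !mxE !inordK//=.
by apply; case=> -[|[|//]] i.
Qed.

Lemma loclip_smooth3 g (a b c : V -> R) : smooth3 g ->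
  loclip p a -> loclip p b -> loclip p c ->
  loclip p (fun x => g (a x) (b x) (c x)).
Proof.
move=> sg la lb lc.
have := @loclip_Ck R V p 3 _ (fun i x => [:: a x; b x; c x]`_i) (sg 1%N).
under [X in loclip _ X]funext => x do rewrite !mxE !inordK//=.
by apply; case=> -[|[|[|//]]] i.
Qed.

End Curried.

(** * Differentiation along a curve with respect to its first coordinate *)

Section DerivativeAlongCurve.
Set Implicit Arguments. Unset Strict Implicit.
Variable R : realType.
Implicit Types (f g : R -> R) (v : R).

Lemma is_deriveV f v df : f v != 0 -> is_derive v 1 f df ->
  is_derive v 1 (fun x => (f x)^-1) (- (f v) ^- 2 * df).
Proof.
move=> fv0 dfv; split; first exact: derivableV.
by rewrite deriveV// derive_val.
Qed.

(* When [u'] is the speed of the first coordinate of a curve, [d] is the derivative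
   of [f] with respect to that coordinate. *)
Definition dalong v u' f (d : R) := is_derive v 1 f (u' * d).

(** Separates the two halves of a computation: [dalong_tac] first builds a derivative from the shape
    of [f], and algebra then identifies it with the announced one. *)
Lemma dalongE v u' f d d' : dalong v u' f d -> d = d' -> dalong v u' f d'.
Proof. by move=> ? <-. Qed.

Lemma dalong_cst v u' c : dalong v u' (fun=> c) 0.
Proof. by rewrite /dalong mulr0; exact: is_derive_cst. Qed.

Lemma dalongD v u' f g d e : dalong v u' f d -> dalong v u' g e ->
  dalong v u' (fun x => f x + g x) (d + e).
Proof. by move=> df dg; rewrite /dalong mulrDr; exact: is_deriveD. Qed.

Lemma dalongN v u' f d : dalong v u' f d ->
  dalong v u' (fun x => - f x) (- d).
Proof. by move=> df; rewrite /dalong mulrN; exact: is_deriveN. Qed.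

Lemma dalongM v u' f g d e : dalong v u' f d -> dalong v u' g e ->
  dalong v u' (fun x => f x * g x) (f v * e + g v * d).
Proof.
move=> df dg; rewrite /dalong.
have := @is_deriveM _ _ _ _ _ _ _ _ df dg; move/is_derive_eq; apply.
by rewrite /GRing.scale/=; ring.
Qed.

Lemma dalongX v u' f d n : dalong v u' f d ->
  dalong v u' (fun x => f x ^+ n) (n%:R * f v ^+ n.-1 * d).
Proof.
move=> df; rewrite /dalong.
have := @is_deriveX _ _ _ n _ _ _ df; rewrite exprfctE; move/is_derive_eq; apply.
by rewrite /GRing.scale/=; ring.
Qed.

Lemma dalongV v u' f d : f v != 0 -> dalong v u' f d ->
  dalong v u' (fun x => (f x)^-1) (- d / f v ^+ 2).
Proof.
move=> fv0 df; rewrite /dalong; have := is_deriveV fv0 df; move/is_derive_eq; apply.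
by field.
Qed.

Lemma dalong_smooth1 g (a : R -> R) v u' a1 : smooth1 g -> dalong v u' a a1 ->
  dalong v u' (fun x => g (a x)) (a1 * pd1 g (a v)).
Proof. by move=> sg da; rewrite /dalong mulrA; exact: smooth1_chain. Qed.

Lemma dalong_smooth2 (g : R -> R -> R) (a : R -> R) s v u' a1 : smooth2 g -> dalong v u' a a1 ->
  dalong v u' (fun x => g (a x) s) (a1 * pd2 g (a v) s).
Proof. by move=> sg da; rewrite /dalong mulrA; exact: smooth2_chain. Qed.

Lemma dalong_smooth3 (g : R -> R -> R -> R) (a b : R -> R) s v u' a1 b1 : smooth3 g ->
  dalong v u' a a1 -> dalong v u' b b1 ->
  dalong v u' (fun x => g (a x) (b x) s)
    (a1 * pd3 0 g (a v) (b v) s + b1 * pd3 1 g (a v) (b v) s).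
Proof.
by move=> sg da db; rewrite /dalong mulrDr !mulrA; exact: smooth3_chain.
Qed.

Lemma is_derive_vec3 (a b c : R -> R) v da db dc :
  is_derive v 1 a da -> is_derive v 1 b db -> is_derive v 1 c dc ->
  is_derive v 1 (fun x => vec3 (a x) (b x) (c x)) (vec3 da db dc).
Proof.
move=> ha hb hc.
have E (i : 'I_1) (j : 'I_3) : is_derive v 1
    (fun x => vec3 (a x) (b x) (c x) i j) (vec3 da db dc i j).
  rewrite (ord1 i); under [X in is_derive v 1 X]funext => x do rewrite mxE.
  by rewrite mxE; case: j => -[|[|[|//]]] /=.
have D : derivable (fun x => vec3 (a x) (b x) (c x)) v 1.
  by apply/derivable_mxP => i j; case: (E i j).
split=> //; rewrite derive_mx//; apply/matrixP => i j; rewrite mxE.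
exact: derive_val.
Qed.

End DerivativeAlongCurve.

(* Hypotheses are compared syntactically: the conversion test of [assumption]
   would unfold the limits that define derivatives.  Many [Let] facts of the later
   sections are used only through this tactic, hence never by name. *)
Ltac exact_hyp := match goal with
  | H : ?P |- ?Q => constr_eq P Q; exact H
  | H : dalong ?v ?d ?f ?e |- dalong ?v ?d ?g _ => constr_eq f g; exact H
  end.

Ltac dalong_tac := repeat first
  [ exact_hyp
  | lazymatch goal with
    | |- dalong _ _ (fun=> ?c) _ => apply dalong_cst
    | |- dalong _ _ (fun x => _ + _) _ => apply dalongD
    | |- dalong _ _ (fun x => - _) _ => apply dalongN
    | |- dalong _ _ (fun x => _ * _) _ => apply dalongM
    | |- dalong _ _ (fun x => _ ^+ _) _ => apply dalongX
    | |- dalong _ _ (fun x => _^-1) _ => apply dalongV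
    | |- dalong _ _ (fun x => ?a x) _ => is_var a; eassumption
    end
  | apply dalong_smooth1; [exact_hyp|]
  | apply dalong_smooth2; [exact_hyp|]
  | apply dalong_smooth3; [exact_hyp| |] ].

(** * Vector operations in coordinates *)

Section Vectors.
Set Implicit Arguments. Unset Strict Implicit.
Variable R : realType.
Implicit Types a b c x y z : R.

Lemma dot3_vec3 a b c x y z :
  dot3 (vec3 a b c) (vec3 x y z) = a * x + b * y + c * z.
Proof. by rewrite /dot3 !big_ord_recl big_ord0 !mxE /= addr0 addrA. Qed.

Lemma scale_vec3 k a b c : k *: vec3 a b c = vec3 (k * a) (k * b) (k * c) :> 'rV[R]_3.
Proof. by apply/rowP => -[[|[|[|//]]] i]; rewrite !mxE. Qed.

Lemma cmp_vec3 a b c :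
  (cmp (vec3 a b c) 0 = a) * (cmp (vec3 a b c) 1 = b) * (cmp (vec3 a b c) 2 = c).
Proof. by rewrite /cmp !mxE !inordK. Qed.

Lemma cross3_vec3 a b c x y z : cross3 (vec3 a b c) (vec3 x y z) =
  vec3 (b * z - c * y) (c * x - a * z) (a * y - b * x).
Proof. by rewrite /cross3 !cmp_vec3. Qed.

Lemma det3_vec3 a1 a2 a3 b1 b2 b3 c1 c2 c3 :
  det3 (vec3 a1 a2 a3) (vec3 b1 b2 b3) (vec3 c1 c2 c3) =
  a1 * (b2 * c3 - b3 * c2) - a2 * (b1 * c3 - b3 * c1)
  + a3 * (b1 * c2 - b2 * c1) :> R.
Proof.
rewrite /det3 (expand_det_row _ ord0) !big_ord_recl big_ord0.
rewrite /cofactor !(expand_det_row _ ord0) !big_ord_recl !big_ord0.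
rewrite /cofactor !det_mx11 !mxE /=.
by rewrite /bump /=; ring.
Qed.

End Vectors.

(* Comparing two applied partial derivatives up to conversion would unfold the
   limits that define them, so they are abstracted before calling [ring]. *)
Ltac abstract_atoms := cbv beta; simpl; repeat match goal with
  | |- context [@pd1 ?R ?g ?u] => generalize (@pd1 R g u); intro
  | |- context [@pd2 ?R ?g ?u ?s] => generalize (@pd2 R g u s); intro
  | |- context [@pd3 ?R ?j ?g ?u ?w ?s] => generalize (@pd3 R j g u w s); intro
  end.

Ltac loclip_tac := repeat first
  [ exact_hyp
  | lazymatch goal with
    | |- loclip _ (fun=> ?c) => apply loclip_cst
    | |- loclip _ (fun x => _ + _) => apply loclipD
    | |- loclip _ (fun x => - _) => apply loclipN
    | |- loclip _ (fun x => _ * _) => apply loclipM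
    | |- loclip _ (fun x => _ ^+ _) => apply loclipX
    end
  | match goal with
    | H : smooth1 ?g |- loclip _ (fun x => ?g' (@?a x)) =>
        constr_eq g g'; apply (@loclip_smooth1 _ _ _ g a H)
    | H : smooth2 ?g |- loclip _ (fun x => ?g' (@?a x) (@?b x)) =>
        constr_eq g g'; apply (@loclip_smooth2 _ _ _ g a b H)
    | H : smooth3 ?g |- loclip _ (fun x => ?g' (@?a x) (@?b x) (@?c x)) =>
        constr_eq g g'; apply (@loclip_smooth3 _ _ _ g a b c H)
    end ].

(** * The terms of the surface that do not involve [v] *)

Section Profile.
Set Implicit Arguments. Unset Strict Implicit.
Variable R : realType.
Variables (g : R -> R) (h : R -> R -> R).

(** Used with ([f21], [f24]) for the second coordinate of the surface and with ([f31], [f34]) for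
    the third. [prof1] and [prof2] are its first two derivatives in [u]. *)
Definition prof (u s : R) := u ^+ 2 * g u + u * s * h u s.
Definition prof1 (u s : R) :=
  2 * u * g u + u ^+ 2 * pd1 g u + s * h u s + u * s * pd2 h u s.
Definition prof2 (u s : R) :=
  2 * g u + 4 * u * pd1 g u + u ^+ 2 * pd1 (pd1 g) u + 2 * s * pd2 h u s
  + u * s * pd2 (pd2 h) u s.

Hypotheses (sg : smooth1 g) (sh : smooth2 h).
Variables (a : R -> R) (s v u' a1 : R).
Hypothesis da : dalong v u' a a1.

Lemma dalong_prof : dalong v u' (fun x => prof (a x) s) (a1 * prof1 (a v) s).
Proof.
rewrite /prof /prof1; apply: dalongE; first by dalong_tac.
by abstract_atoms; ring.
Qed.

Lemma dalong_prof1 : dalong v u' (fun x => prof1 (a x) s) (a1 * prof2 (a v) s).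
Proof.
have s1 := smooth1_pd sg; have s2 := smooth2_pd sh.
rewrite /prof1 /prof2; apply: dalongE; first by dalong_tac.
by abstract_atoms; ring.
Qed.
End Profile.

(** * Explicit formulas for the tangent, acceleration, normal and curvatures *)

Section Surface.
Set Implicit Arguments. Unset Strict Implicit.
Variable R : realType.
Variables (f21 f31 : R -> R) (f24 f34 c0 c1 : R -> R -> R) (c2 c3 : R -> R -> R -> R).

Notation c2u := (pd3 0 c2). Notation c2w := (pd3 1 c2).
Notation c3u := (pd3 0 c3). Notation c3w := (pd3 1 c3).

(* [c1 + w c3 = 0] defines [w] as a function of [u] with derivative [slope];
   [slope1] is the derivative of [slope] along this curve. *)
Definition eq_u (u w s : R) := pd2 c1 u s + w * c3u u w s.
Definition eq_w (u w s : R) := c3 u w s + w * c3w u w s.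
Definition slope (u w s : R) := - eq_u u w s / eq_w u w s.
(** In [eq_u1], [eq_w1], [ev_u1] and [ev_w1] the final [1] marks the total derivative in [u] along
    the curve, on which dw/du is [slope]. *)
Definition eq_u1 (u w s : R) := pd2 (pd2 c1) u s + slope u w s * c3u u w s
  + w * (pd3 0 c3u u w s + slope u w s * pd3 1 c3u u w s).
Definition eq_w1 (u w s : R) := c3u u w s + slope u w s * c3w u w s
  + slope u w s * c3w u w s
  + w * (pd3 0 c3w u w s + slope u w s * pd3 1 c3w u w s).
Definition slope1 (u w s : R) :=
  - (eq_u1 u w s * eq_w u w s - eq_u u w s * eq_w1 u w s) / eq_w u w s ^+ 2.

(** The part of [f32] that is even in [v], with [w] for the square of [v]. The odd part is [v] times
    [c1 + w c3], so on the self-intersection curve only [ev] remains. *)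
Definition ev (u w s : R) := c0 u s + w * c2 u w s.
Definition ev_u (u w s : R) := pd2 c0 u s + w * c2u u w s.
Definition ev_w (u w s : R) := c2 u w s + w * c2w u w s.
Definition ev_u1 (u w s : R) := pd2 (pd2 c0) u s + slope u w s * c2u u w s
  + w * (pd3 0 c2u u w s + slope u w s * pd3 1 c2u u w s).
Definition ev_w1 (u w s : R) := c2u u w s + slope u w s * c2w u w s
  + slope u w s * c2w u w s
  + w * (pd3 0 c2w u w s + slope u w s * pd3 1 c2w u w s).

(* [(1, tan2, tan3)] and [(0, acc2, acc3)] are the first two derivatives of the
   self-intersection curve parametrised by [u]. *)
Definition tan2 (u w s : R) := prof1 f21 f24 u s + slope u w s.
Definition tan3 (u w s : R) := prof1 f31 f34 u s + slope u w s * ev u w s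
  + w * (ev_u u w s + slope u w s * ev_w u w s).
Definition acc2 (u w s : R) := prof2 f21 f24 u s + slope1 u w s.
Definition acc3 (u w s : R) := prof2 f31 f34 u s + slope1 u w s * ev u w s
  + 2 * slope u w s * (ev_u u w s + slope u w s * ev_w u w s)
  + w * (ev_u1 u w s + slope1 u w s * ev_w u w s + slope u w s * ev_w1 u w s).

Definition f3u (u v s : R) := prof1 f31 f34 u s + v ^+ 2 *
  (pd2 c0 u s + v * pd2 c1 u s + v ^+ 2 * c2u u (v ^+ 2) s
   + v ^+ 3 * c3u u (v ^+ 2) s).
(* [f_v / v = (0, 2, f3v)] *)
Definition f3v (u v s : R) := 2 * f32 c0 c1 c2 c3 u v s
  + v * (c1 u s + 2 * v * c2 u (v ^+ 2) s + 2 * v ^+ 3 * c2w u (v ^+ 2) s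
         + 3 * v ^+ 2 * c3 u (v ^+ 2) s + 2 * v ^+ 4 * c3w u (v ^+ 2) s).
(* The normal [f_u x (f_v / v)] is [(nor1, nor2, 2)]. *)
Definition nor1 (u v s : R) := prof1 f21 f24 u s * f3v u v s - 2 * f3u u v s.
Definition nor2 (u v s : R) := - f3v u v s.

Definition tnorm (u w s : R) :=
  Num.sqrt (1 + tan2 u w s ^+ 2 + tan3 u w s ^+ 2).
Definition nnorm (u v s : R) :=
  Num.sqrt (nor1 u v s ^+ 2 + nor2 u v s ^+ 2 + 4).

(** The numerators of [Kg] and [Kn] are det(T, E, n) and E . n, expanded. Unlike the quotients
    defining the curvatures, these expressions do not degenerate at [v = 0]. *)
Definition Kg (u v s : R) :=
  (2 * acc2 u (v ^+ 2) s - acc3 u (v ^+ 2) s * nor2 u v s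
   + tan2 u (v ^+ 2) s * acc3 u (v ^+ 2) s * nor1 u v s
   - tan3 u (v ^+ 2) s * acc2 u (v ^+ 2) s * nor1 u v s)
  / (nnorm u v s * tnorm u (v ^+ 2) s ^+ 3).
Definition Kn (u v s : R) :=
  (acc2 u (v ^+ 2) s * nor2 u v s + 2 * acc3 u (v ^+ 2) s)
  / (nnorm u v s * tnorm u (v ^+ 2) s ^+ 2).

Hypotheses (sf21 : smooth1 f21) (sf31 : smooth1 f31) (sf24 : smooth2 f24)
  (sf34 : smooth2 f34) (sc0 : smooth2 c0) (sc1 : smooth2 c1)
  (sc2 : smooth3 c2) (sc3 : smooth3 c3).

(** * Derivatives along the self-intersection curve *)

Section Along.
Variables (U : R -> R) (s v u' : R).
Hypothesis dU : is_derive v 1 U u'.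
Hypothesis u'slope : u' * slope (U v) (v ^+ 2) s = 2 * v.
Hypothesis eqw0 : eq_w (U v) (v ^+ 2) s != 0.

Let dalongU : dalong v u' U 1.
Proof. by rewrite /dalong mulr1. Qed.

(** By [u'slope], the square of [v] is differentiated as a function of [u]. No division by [u']
    occurs, so the computation remains valid at [v = 0], where [u'] vanishes if [slope] does not. *)
Let dalong_sqr : dalong v u' (fun x => x ^+ 2) (slope (U v) (v ^+ 2) s).
Proof.
rewrite /dalong u'slope.
have := @is_deriveX _ _ id 2 v 1 1 (is_derive_id _ _); rewrite exprfctE.
by move/is_derive_eq; apply; rewrite /GRing.scale/= mulr1 expr1.
Qed.

Let dalong_eq_u : dalong v u' (fun x => eq_u (U x) (x ^+ 2) s)
  (eq_u1 (U v) (v ^+ 2) s).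
Proof.
have s1 := smooth2_pd sc1; have s2 := smooth3_pd 0 sc3.
rewrite /eq_u /eq_u1; apply: dalongE; first by dalong_tac.
by abstract_atoms; ring.
Qed.

Let dalong_eq_w : dalong v u' (fun x => eq_w (U x) (x ^+ 2) s)
  (eq_w1 (U v) (v ^+ 2) s).
Proof.
have s2 := smooth3_pd 1 sc3.
rewrite /eq_w /eq_w1; apply: dalongE; first by dalong_tac.
by abstract_atoms; ring.
Qed.

Let dalong_slope : dalong v u' (fun x => slope (U x) (x ^+ 2) s)
  (slope1 (U v) (v ^+ 2) s).
Proof.
rewrite /slope /slope1; apply: dalongE; first by dalong_tac.
move: eqw0; move: (eq_w _ _ _) (eq_u _ _ _) (eq_u1 _ _ _) (eq_w1 _ _ _).
by move=> a b c d a0; field.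
Qed.

Let dalong_ev : dalong v u' (fun x => ev (U x) (x ^+ 2) s)
  (ev_u (U v) (v ^+ 2) s + slope (U v) (v ^+ 2) s * ev_w (U v) (v ^+ 2) s).
Proof.
rewrite /ev /ev_u /ev_w; apply: dalongE; first by dalong_tac.
by abstract_atoms; ring.
Qed.

Let dalong_ev_u : dalong v u' (fun x => ev_u (U x) (x ^+ 2) s)
  (ev_u1 (U v) (v ^+ 2) s).
Proof.
have s1 := smooth2_pd sc0; have s2 := smooth3_pd 0 sc2.
rewrite /ev_u /ev_u1; apply: dalongE; first by dalong_tac.
by abstract_atoms; ring.
Qed.

Let dalong_ev_w : dalong v u' (fun x => ev_w (U x) (x ^+ 2) s)
  (ev_w1 (U v) (v ^+ 2) s).
Proof.
have s2 := smooth3_pd 1 sc2.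
rewrite /ev_w /ev_w1; apply: dalongE; first by dalong_tac.
by abstract_atoms; ring.
Qed.

Lemma dalong_curve2 : dalong v u' (fun x => prof f21 f24 (U x) s + x ^+ 2)
  (tan2 (U v) (v ^+ 2) s).
Proof.
have h := dalong_prof sf21 sf24 s dalongU.
apply: dalongE; first by dalong_tac.
by rewrite /tan2; abstract_atoms; ring.
Qed.

Lemma dalong_curve3 :
  dalong v u' (fun x => prof f31 f34 (U x) s + x ^+ 2 * ev (U x) (x ^+ 2) s)
  (tan3 (U v) (v ^+ 2) s).
Proof.
have h := dalong_prof sf31 sf34 s dalongU.
apply: dalongE; first by dalong_tac.
by rewrite /tan3; ring.
Qed.

Lemma dalong_tan2 : dalong v u' (fun x => tan2 (U x) (x ^+ 2) s)
  (acc2 (U v) (v ^+ 2) s).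
Proof.
have h := dalong_prof1 sf21 sf24 s dalongU.
rewrite /tan2; apply: dalongE; first by dalong_tac.
by rewrite /acc2; ring.
Qed.

Lemma dalong_tan3 : dalong v u' (fun x => tan3 (U x) (x ^+ 2) s)
  (acc3 (U v) (v ^+ 2) s).
Proof.
have h := dalong_prof1 sf31 sf34 s dalongU.
rewrite /tan3; apply: dalongE; first by dalong_tac.
by rewrite /acc3; ring.
Qed.

End Along.

(** * First derivatives and unit normal of the surface *)

Local Notation F := (surf_f f21 f31 f24 f34 c0 c1 c2 c3).

Lemma surf_fE u v s : F u v s =
  vec3 u (prof f21 f24 u s + v ^+ 2)
    (prof f31 f34 u s + v ^+ 2 * f32 c0 c1 c2 c3 u v s).
Proof. by rewrite /surf_f /prof; congr vec3; ring. Qed.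

Lemma surf_fu (u v s : R) : is_derive u 1 (fun x => F x v s)
  (vec3 1 (prof1 f21 f24 u s) (f3u u v s)).
Proof.
have di : dalong u 1 (fun x : R => x) 1.
  by rewrite /dalong mulr1; exact: is_derive_id.
have h2 := dalong_prof sf21 sf24 s di; have h3 := dalong_prof sf31 sf34 s di.
under [X in is_derive u 1 X]funext => x do rewrite surf_fE.
apply: is_derive_vec3.
- have : dalong u 1 (fun x => prof f21 f24 x s + v ^+ 2) (prof1 f21 f24 u s).
    by apply: dalongE; [dalong_tac|rewrite addr0 mul1r].
  by rewrite /dalong mul1r.
- have : dalong u 1 (fun x => prof f31 f34 x s + v ^+ 2 * f32 c0 c1 c2 c3 x v s)
      (f3u u v s).
    rewrite /f32 /f3u; apply: dalongE; first by dalong_tac.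
    by abstract_atoms; ring.
  by rewrite /dalong mul1r.
Qed.

Lemma surf_fv (u v s : R) : is_derive v 1 (fun y => F u y s)
  (vec3 0 (2 * v) (v * f3v u v s)).
Proof.
have di : dalong v 1 (fun x : R => x) 1.
  by rewrite /dalong mulr1; exact: is_derive_id.
have dc : dalong v 1 (fun _ : R => u) 0 by exact: dalong_cst.
have dX : dalong v 1 (fun x => x ^+ 2) (2 * v).
  by apply: dalongE; [dalong_tac|rewrite /=; ring].
under [X in is_derive v 1 X]funext => x do rewrite surf_fE.
apply: is_derive_vec3.
- have : dalong v 1 (fun x => prof f21 f24 u s + x ^+ 2) (2 * v).
    by apply: dalongE; [dalong_tac|rewrite add0r].
  by rewrite /dalong mul1r.
- have : dalong v 1 (fun x => prof f31 f34 u s + x ^+ 2 * f32 c0 c1 c2 c3 u x s)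
      (v * f3v u v s).
    rewrite /f3v /f32; apply: dalongE; first by dalong_tac.
    by abstract_atoms; ring.
  by rewrite /dalong mul1r.
Qed.

Lemma unit_normal_surf u v s : v != 0 -> unit_normal F u v s =
  (nnorm u v s)^-1 *: vec3 (nor1 u v s) (nor2 u v s) 2.
Proof.
move=> v0; rewrite /unit_normal !derive1E.
rewrite (@derive_val _ _ _ _ _ _ _ (surf_fu u v s)).
rewrite (@derive_val _ _ _ _ _ _ _ (surf_fv u v s)).
rewrite /nnorm /nor1 /nor2.
move: (f3u u v s) (f3v u v s) (prof1 f21 f24 u s) => a b p.
have -> : v^-1 *: vec3 0 (2 * v) (v * b) = vec3 0 2 b.
  by rewrite scale_vec3 mulr0 mulKf// mulrC mulfK.
have -> : cross3 (vec3 1 p a) (vec3 0 2 b) = vec3 (p * b - 2 * a) (- b) 2.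
  by rewrite cross3_vec3; congr vec3; ring.
by congr (_^-1 *: _); rewrite /enorm3 dot3_vec3; congr Num.sqrt; ring.
Qed.

(** * Curvatures of the self-intersection curve for a fixed parameter *)

Section Curve.
Variables (U : R -> R) (s eps : R).
Hypothesis dU : forall y : R, `|y| < eps -> derivable U y 1.
Hypothesis dU1 : forall y : R, `|y| < eps -> derivable (derive1 U) y 1.
Hypothesis eqU : forall y, `|y| < eps ->
  c1 (U y) s + y ^+ 2 * c3 (U y) (y ^+ 2) s = 0.
Hypothesis equ0 : forall y, `|y| < eps -> eq_u (U y) (y ^+ 2) s != 0.
Hypothesis eqw0 : forall y, `|y| < eps -> eq_w (U y) (y ^+ 2) s != 0.

Let c y := F (U y) y s.

Let near_eps (y : R) : `|y| < eps -> \forall z \near y, `|z| < eps.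
Proof.
move=> ye; apply/nbhs_ballP; exists (eps - `|y|); rewrite /= ?subr_gt0// => z.
rewrite -ball_normE /= distrC => yz; have := ler_normD y (z - y).
by rewrite subrKC; lra.
Qed.

Let is_dU (y : R) : `|y| < eps -> is_derive y 1 U (derive1 U y).
Proof. by move=> ye; rewrite derive1E; apply/derivableP/dU. Qed.

(** The left side of [eqU] vanishes identically near [y], so its derivative
    [U' * eq_u + 2 * y * eq_w] is zero; dividing by [eq_w] gives the relation. *)
Let U1slope (y : R) : `|y| < eps -> derive1 U y * slope (U y) (y ^+ 2) s = 2 * y.
Proof.
move=> ye; have dy := is_dU ye.
have d2 : is_derive y 1 (fun x => x ^+ 2) (2 * y).
  have := @is_deriveX _ _ id 2 y 1 1 (is_derive_id _ _); rewrite exprfctE.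
  by move/is_derive_eq; apply; rewrite /GRing.scale/= mulr1 expr1.
have d1 : is_derive y 1 (fun x => c1 (U x) s + x ^+ 2 * c3 (U x) (x ^+ 2) s)
    (derive1 U y * eq_u (U y) (y ^+ 2) s + 2 * y * eq_w (U y) (y ^+ 2) s).
  have := @is_deriveD _ _ _ _ _ _ _ _ _ (smooth2_chain s sc1 dy)
    (@is_deriveM _ _ _ _ _ _ _ _ d2 (smooth3_chain s sc3 dy d2)).
  move/is_derive_eq; apply; rewrite /GRing.scale /eq_u /eq_w.
  by abstract_atoms; ring.
have d0 : is_derive y 1 (fun x => c1 (U x) s + x ^+ 2 * c3 (U x) (x ^+ 2) s) 0.
  apply: near_eq_is_derive (is_derive_cst 0 y 1).
  by apply: filterS (near_eps ye) => z ze; rewrite eqU.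
have := @derive_val _ _ _ _ _ _ _ d0.
rewrite (@derive_val _ _ _ _ _ _ _ d1) => /eqP; rewrite addr_eq0 => /eqP E.
rewrite /slope mulrA mulrN E opprK mulfK// eqw0//.
Qed.

Let derive1_c (y : R) : `|y| < eps -> derive1 c y =
  vec3 (derive1 U y) (derive1 U y * tan2 (U y) (y ^+ 2) s)
    (derive1 U y * tan3 (U y) (y ^+ 2) s).
Proof.
move=> ye; rewrite derive1E; apply: derive_val.
apply: (@near_eq_is_derive _ _ _ (fun x => vec3 (U x)
    (prof f21 f24 (U x) s + x ^+ 2)
    (prof f31 f34 (U x) s + x ^+ 2 * ev (U x) (x ^+ 2) s))).
  apply: filterS (near_eps ye) => z ze; rewrite /c surf_fE; congr vec3.
  rewrite /ev /f32; congr (_ + _ * _).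
  (* Splits [f32] into its even and odd parts in [z]; the odd part is killed by [eqU]. *)
  transitivity (c0 (U z) s + z ^+ 2 * c2 (U z) (z ^+ 2) s +
    z * (c1 (U z) s + z ^+ 2 * c3 (U z) (z ^+ 2) s)); last by ring.
  by rewrite eqU// mulr0 addr0.
apply: is_derive_vec3; first exact: is_dU.
- exact: dalong_curve2 (is_dU ye) (U1slope ye).
- exact: dalong_curve3 (is_dU ye) (U1slope ye).
Qed.

(** Since c' = U' T and T has derivative U' E in the parameter [v], the product rule gives c'' = U''
    T + U'^2 E. *)
Let derive2_c (y : R) : `|y| < eps -> derive1 (derive1 c) y =
  vec3 (derive1 (derive1 U) y)
    (derive1 (derive1 U) y * tan2 (U y) (y ^+ 2) s
     + derive1 U y ^+ 2 * acc2 (U y) (y ^+ 2) s)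
    (derive1 (derive1 U) y * tan3 (U y) (y ^+ 2) s
     + derive1 U y ^+ 2 * acc3 (U y) (y ^+ 2) s).
Proof.
move=> ye; rewrite derive1E; apply: derive_val.
apply: (@near_eq_is_derive _ _ _ (fun y => vec3 (derive1 U y)
    (derive1 U y * tan2 (U y) (y ^+ 2) s)
    (derive1 U y * tan3 (U y) (y ^+ 2) s))).
  by apply: filterS (near_eps ye) => z ze; rewrite derive1_c.
have h1 : is_derive y 1 (derive1 U) (derive1 (derive1 U) y).
  by rewrite (derive1E (derive1 U)); apply/derivableP/dU1.
have h2 := dalong_tan2 (is_dU ye) (U1slope ye) (eqw0 ye).
have h3 := dalong_tan3 (is_dU ye) (U1slope ye) (eqw0 ye).
apply: is_derive_vec3 => //.
- have := @is_deriveM _ _ _ _ _ _ _ _ h1 h2.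
  by move/is_derive_eq; apply; rewrite /GRing.scale/=; ring.
- have := @is_deriveM _ _ _ _ _ _ _ _ h1 h3.
  by move/is_derive_eq; apply; rewrite /GRing.scale/=; ring.
Qed.

(** Orthogonality of T and n. After replacing [c1] by means of [eqU], the scalar product is a
    multiple of [eq_u + slope * eq_w], which is zero by the choice of [slope]. *)
Let tangent_normal (y : R) : `|y| < eps ->
  nor1 (U y) y s + tan2 (U y) (y ^+ 2) s * nor2 (U y) y s
  + 2 * tan3 (U y) (y ^+ 2) s = 0.
Proof.
move=> ye.
have E : c1 (U y) s = - (y ^+ 2 * c3 (U y) (y ^+ 2) s).
  by apply/eqP; rewrite -addr_eq0 eqU.
have S : eq_u (U y) (y ^+ 2) s + slope (U y) (y ^+ 2) s * eq_w (U y) (y ^+ 2) s = 0.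
  by rewrite /slope mulfVK ?eqw0// subrr.
have -> : nor1 (U y) y s + tan2 (U y) (y ^+ 2) s * nor2 (U y) y s
  + 2 * tan3 (U y) (y ^+ 2) s = - 2 * y ^+ 3 *
   (eq_u (U y) (y ^+ 2) s + slope (U y) (y ^+ 2) s * eq_w (U y) (y ^+ 2) s).
  rewrite /nor1 /tan2 /nor2 /tan3 /f3u /f3v /f32 /ev /ev_u /ev_w E.
  move: (slope _ _ _) => sl; rewrite /eq_u /eq_w.
  move: (prof1 f21 _ _ _) (prof1 f31 _ _ _) => p q.
  by abstract_atoms; ring.
by rewrite S mulr0.
Qed.

Let slope0 (y : R) : `|y| < eps -> slope (U y) (y ^+ 2) s != 0.
Proof. by move=> ye; rewrite mulf_neq0 ?oppr_eq0 ?invr_eq0 ?equ0 ?eqw0. Qed.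

Let tnorm_gt0 u w : 0 < tnorm u w s.
Proof. by rewrite sqrtr_gt0 ltr_wpDr ?sqr_ge0// ltr_wpDr ?sqr_ge0. Qed.

Let nnorm_gt0 u v : 0 < nnorm u v s.
Proof. by rewrite sqrtr_gt0 ltr_wpDl// addr_ge0 ?sqr_ge0. Qed.

Let enorm3_derive1_c (y : R) : `|y| < eps ->
  enorm3 (derive1 c y) = `|derive1 U y| * tnorm (U y) (y ^+ 2) s.
Proof.
move=> ye; rewrite derive1_c// /enorm3 dot3_vec3 /tnorm -sqrtr_sqr.
by rewrite -sqrtrM ?sqr_ge0//; congr Num.sqrt; ring.
Qed.

Let U1_neq0 (y : R) : 0 < `|y| < eps -> derive1 U y != 0.
Proof.
move=> /andP[y0 ye]; apply/eqP => U0; have := U1slope ye.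
by rewrite U0 mul0r => /esym/eqP; rewrite mulf_eq0 pnatr_eq0/= -normr_eq0 gt_eqF.
Qed.

(** The term U'' T of c'' drops out of the determinant, leaving U'^3 over |U'|^3, that is, the sign
    of U'. By [U1slope] this sign is that of [v] times that of [slope]. *)
Lemma kappa_gE (v : R) : 0 < `|v| < eps -> kappa_g F U s v =
  Num.sg v * Num.sg (slope (U v) (v ^+ 2) s) * Kg (U v) v s.
Proof.
move=> v0e; have a0 := U1_neq0 v0e; have /andP[v0 ve] := v0e.
have -> : Num.sg v * Num.sg (slope (U v) (v ^+ 2) s) = Num.sg (derive1 U v).
  have -> : Num.sg v = Num.sg (2 * v) by rewrite sgrM (gtr0_sg (ltr0Sn _ 1)) mul1r.
  rewrite -(U1slope ve) sgrM -mulrA -expr2 sqr_sg slope0// mulr1//.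
rewrite /kappa_g -/c enorm3_derive1_c// derive1_c// derive2_c//.
rewrite unit_normal_surf -?normr_gt0// scale_vec3 det3_vec3 /Kg.
have := nnorm_gt0 (U v) v; have := tnorm_gt0 (U v) (v ^+ 2).
move: a0; move: (derive1 U v) (derive1 (derive1 U) v) (nnorm _ _ _) (tnorm _ _ _).
move: (acc2 _ _ _) (acc3 _ _ _) (tan2 _ _ _) (tan3 _ _ _) (nor1 _ _ _) (nor2 _ _ _).
move=> e2 e3 t2 t3 n1 n2 a b N T a0 T0 N0.
have [{}a0|{}a0|/eqP] := ltgtP a 0; last by rewrite (negbTE a0).
- rewrite ltr0_norm// ltr0_sg//; field.
  by rewrite ?(gt_eqF N0) ?(gt_eqF T0) ?(lt_eqF a0).
- rewrite gtr0_norm// gtr0_sg//; field.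
  by rewrite ?(gt_eqF N0) ?(gt_eqF T0) ?(gt_eqF a0).
Qed.

(** Here U'' T is removed by orthogonality to n, and the remaining factor U'^2 cancels; hence no
    sign appears and both one-sided limits agree. *)
Lemma kappa_nE (v : R) : 0 < `|v| < eps -> kappa_n F U s v = Kn (U v) v s.
Proof.
move=> v0e; have a0 := U1_neq0 v0e; have /andP[v0 ve] := v0e.
rewrite /kappa_n -/c enorm3_derive1_c// derive2_c//.
rewrite unit_normal_surf -?normr_gt0// scale_vec3 dot3_vec3 /Kn.
have := nnorm_gt0 (U v) v; have := tnorm_gt0 (U v) (v ^+ 2).
have := tangent_normal ve.
move: a0; move: (derive1 U v) (derive1 (derive1 U) v) (nnorm _ _ _) (tnorm _ _ _).
move: (acc2 _ _ _) (acc3 _ _ _) (tan2 _ _ _) (tan3 _ _ _) (nor1 _ _ _) (nor2 _ _ _).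
move=> e2 e3 t2 t3 n1 n2 a b N T a0 tn T0 N0.
(* Eliminating [n1] through orthogonality makes the terms in U'' cancel in [field]. *)
have -> : n1 = - (t2 * n2 + 2 * t3) by apply/eqP; rewrite -addr_eq0 addrA tn.
rewrite exprMn real_normK ?num_real//; field.
by rewrite ?(gt_eqF N0) ?(gt_eqF T0) ?a0.
Qed.

End Curve.

(** * Lipschitz estimates at the origin and values there *)

Section LipschitzAtOrigin.
Variables (V : normedModType R) (p : V) (pu pv ps : V -> R).
Hypotheses (lu : loclip p pu) (lv : loclip p pv) (ls : loclip p ps).
Hypotheses (pu0 : pu p = 0) (pv0 : pv p = 0) (ps0 : ps p = 0).

Hypothesis c3_0 : c3 0 0 0 != 0.
Hypothesis c0_0 : c0 0 0 = 0.
Hypothesis c1u_0 : pd2 c1 0 0 = 0.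

Let lip_prof1 g h : smooth1 g -> smooth2 h ->
  loclip p (fun z => prof1 g h (pu z) (ps z)).
Proof.
move=> sg sh; have s1 := smooth1_pd sg; have s2 := smooth2_pd sh.
by rewrite /prof1; loclip_tac.
Qed.

Let lip_prof2 g h : smooth1 g -> smooth2 h ->
  loclip p (fun z => prof2 g h (pu z) (ps z)).
Proof.
move=> sg sh; have s1 := smooth1_pd sg; have s2 := smooth2_pd sh.
have s3 := smooth1_pd s1; have s4 := smooth2_pd s2.
by rewrite /prof2; loclip_tac.
Qed.

Let lip_eq_u : loclip p (fun z => eq_u (pu z) (pv z ^+ 2) (ps z)).
Proof.
have s1 := smooth2_pd sc1; have s2 := smooth3_pd 0 sc3.
by rewrite /eq_u; loclip_tac.
Qed.

Let lip_eq_w : loclip p (fun z => eq_w (pu z) (pv z ^+ 2) (ps z)).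
Proof.
have s2 := smooth3_pd 1 sc3; by rewrite /eq_w; loclip_tac.
Qed.

Let eq_w_0 : eq_w 0 0 0 = c3 0 0 0.
Proof. by rewrite /eq_w mul0r addr0. Qed.

Let sqr0 : (0 : R) ^+ 2 = 0. Proof. by rewrite expr0n. Qed.

Let lip_eq_wV : loclip p (fun z => (eq_w (pu z) (pv z ^+ 2) (ps z))^-1).
Proof. by apply: loclipV => //; rewrite pu0 pv0 ps0 sqr0 eq_w_0. Qed.

Let lip_slope : loclip p (fun z => slope (pu z) (pv z ^+ 2) (ps z)).
Proof. by rewrite /slope; loclip_tac. Qed.

Let lip_eq_u1 : loclip p (fun z => eq_u1 (pu z) (pv z ^+ 2) (ps z)).
Proof.
have s1 := smooth2_pd (smooth2_pd sc1); have s2 := smooth3_pd 0 sc3.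
have s3 := smooth3_pd 0 s2; have s4 := smooth3_pd 1 s2.
by rewrite /eq_u1; loclip_tac.
Qed.

Let lip_eq_w1 : loclip p (fun z => eq_w1 (pu z) (pv z ^+ 2) (ps z)).
Proof.
have s1 := smooth3_pd 0 sc3; have s2 := smooth3_pd 1 sc3.
have s3 := smooth3_pd 0 s2; have s4 := smooth3_pd 1 s2.
by rewrite /eq_w1; loclip_tac.
Qed.

Let lip_slope1 : loclip p (fun z => slope1 (pu z) (pv z ^+ 2) (ps z)).
Proof.
rewrite /slope1; apply: loclipM; first by loclip_tac.
(* A power of the inverse replaces the inverse of a power, so that [lip_eq_wV] applies. *)
under eq_fun do rewrite -exprVn; by loclip_tac.
Qed.

Let lip_ev : loclip p (fun z => ev (pu z) (pv z ^+ 2) (ps z)).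
Proof. by rewrite /ev; loclip_tac. Qed.

Let lip_ev_u : loclip p (fun z => ev_u (pu z) (pv z ^+ 2) (ps z)).
Proof.
have s1 := smooth2_pd sc0; have s2 := smooth3_pd 0 sc2.
by rewrite /ev_u; loclip_tac.
Qed.

Let lip_ev_w : loclip p (fun z => ev_w (pu z) (pv z ^+ 2) (ps z)).
Proof.
have s2 := smooth3_pd 1 sc2; by rewrite /ev_w; loclip_tac.
Qed.

Let lip_ev_u1 : loclip p (fun z => ev_u1 (pu z) (pv z ^+ 2) (ps z)).
Proof.
have s1 := smooth2_pd (smooth2_pd sc0); have s2 := smooth3_pd 0 sc2.
have s3 := smooth3_pd 0 s2; have s4 := smooth3_pd 1 s2.
by rewrite /ev_u1; loclip_tac.
Qed.

Let lip_ev_w1 : loclip p (fun z => ev_w1 (pu z) (pv z ^+ 2) (ps z)).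
Proof.
have s1 := smooth3_pd 0 sc2; have s2 := smooth3_pd 1 sc2.
have s3 := smooth3_pd 0 s2; have s4 := smooth3_pd 1 s2.
by rewrite /ev_w1; loclip_tac.
Qed.

Let lip_tan2 : loclip p (fun z => tan2 (pu z) (pv z ^+ 2) (ps z)).
Proof. by have h := lip_prof1 sf21 sf24; rewrite /tan2; loclip_tac. Qed.

Let lip_tan3 : loclip p (fun z => tan3 (pu z) (pv z ^+ 2) (ps z)).
Proof. by have h := lip_prof1 sf31 sf34; rewrite /tan3; loclip_tac. Qed.

Let lip_acc2 : loclip p (fun z => acc2 (pu z) (pv z ^+ 2) (ps z)).
Proof. by have h := lip_prof2 sf21 sf24; rewrite /acc2; loclip_tac. Qed.

Let lip_acc3 : loclip p (fun z => acc3 (pu z) (pv z ^+ 2) (ps z)).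
Proof. by have h := lip_prof2 sf31 sf34; rewrite /acc3; loclip_tac. Qed.

Let lip_f3u : loclip p (fun z => f3u (pu z) (pv z) (ps z)).
Proof.
have h := lip_prof1 sf31 sf34; have s0 := smooth2_pd sc0.
have s1 := smooth2_pd sc1; have s2 := smooth3_pd 0 sc2.
by have s3 := smooth3_pd 0 sc3; rewrite /f3u; loclip_tac.
Qed.

Let lip_f3v : loclip p (fun z => f3v (pu z) (pv z) (ps z)).
Proof.
have s2 := smooth3_pd 1 sc2; have s3 := smooth3_pd 1 sc3.
by rewrite /f3v /f32; loclip_tac.
Qed.

Let lip_nor1 : loclip p (fun z => nor1 (pu z) (pv z) (ps z)).
Proof. by have h := lip_prof1 sf21 sf24; rewrite /nor1; loclip_tac. Qed.

Let lip_nor2 : loclip p (fun z => nor2 (pu z) (pv z) (ps z)).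
Proof. by rewrite /nor2; loclip_tac. Qed.

Let slope_0 : slope 0 0 0 = 0.
Proof. by rewrite /slope /eq_u c1u_0 mul0r addr0 oppr0 mul0r. Qed.

Let prof1_0 (g : R -> R) (h : R -> R -> R) : prof1 g h 0 0 = 0.
Proof. by rewrite /prof1; ring. Qed.

Let prof2_0 (g : R -> R) (h : R -> R -> R) : prof2 g h 0 0 = 2 * g 0.
Proof. by rewrite /prof2; abstract_atoms; ring. Qed.

Let slope1_0 : slope1 0 0 0 = - pd2 (pd2 c1) 0 0 / c3 0 0 0.
Proof.
rewrite /slope1 eq_w_0 /eq_u c1u_0 /eq_u1 slope_0 !mul0r !addr0 mul0r subr0.
by rewrite !mulNr expr2 invfM mulrA mulfK.
Qed.

Let ev_0 : ev 0 0 0 = 0.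
Proof. by rewrite /ev c0_0 mul0r addr0. Qed.

Let tan2_0 : tan2 0 0 0 = 0.
Proof. by rewrite /tan2 prof1_0 slope_0 addr0. Qed.

Let tan3_0 : tan3 0 0 0 = 0.
Proof. by rewrite /tan3 prof1_0 slope_0 !mul0r !addr0. Qed.

Let acc2_0 : acc2 0 0 0 = 2 * f21 0 - pd2 (pd2 c1) 0 0 / c3 0 0 0.
Proof. by rewrite /acc2 prof2_0 slope1_0 mulNr. Qed.

Let acc3_0 : acc3 0 0 0 = 2 * f31 0.
Proof. by rewrite /acc3 prof2_0 slope_0 ev_0 !(mulr0, mul0r, addr0). Qed.

Let nor2_0 : nor2 0 0 0 = 0.
Proof. by rewrite /nor2 /f3v /f32 c0_0 !expr0n /= !(mul0r, addr0, mulr0, oppr0). Qed.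

Let nor1_0 : nor1 0 0 0 = 0.
Proof.
by rewrite /nor1 prof1_0 /f3u prof1_0 sqr0 !mul0r addr0 mulr0 subr0.
Qed.

Let tnorm_0 : tnorm 0 0 0 = 1.
Proof. by rewrite /tnorm tan2_0 tan3_0 sqr0 !addr0 sqrtr1. Qed.

Let nnorm_0 : nnorm 0 0 0 = 2.
Proof.
rewrite /nnorm nor1_0 nor2_0 sqr0 !add0r.
have -> : 4 = 2 ^+ 2 :> R by ring.
by rewrite sqrtr_sqr ger0_norm.
Qed.

(** At the origin [slope] vanishes together with the derivative of [c1] in [u]. So T = (1, 0, 0) and
    n = (0, 0, 2), and [Kg] and [Kn] reduce to [acc2] and [acc3]. *)
Lemma Kg_0 : Kg 0 0 0 = 2 * f21 0 - pd2 (pd2 c1) 0 0 / c3 0 0 0.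
Proof.
rewrite /Kg sqr0 tnorm_0 nnorm_0 nor1_0 nor2_0 acc2_0.
by rewrite !mulr0 !(subr0, addr0) expr1n mulr1 mulrC mulKf.
Qed.

Lemma Kn_0 : Kn 0 0 0 = 2 * f31 0.
Proof.
rewrite /Kn sqr0 tnorm_0 nnorm_0 nor2_0 acc3_0.
by rewrite !mulr0 add0r expr1n mulr1 mulrC mulKf.
Qed.

Let lip_tnormV : loclip p (fun z => (tnorm (pu z) (pv z ^+ 2) (ps z))^-1).
Proof.
apply: loclipV; last by rewrite pu0 pv0 ps0 sqr0 tnorm_0 oner_neq0.
apply: loclip_sqrt; first by loclip_tac.
by rewrite pu0 pv0 ps0 sqr0 tan2_0 tan3_0 sqr0 !addr0.
Qed.

Let lip_nnormV : loclip p (fun z => (nnorm (pu z) (pv z) (ps z))^-1).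
Proof.
apply: loclipV; last by rewrite pu0 pv0 ps0 nnorm_0.
apply: loclip_sqrt; first by loclip_tac.
by rewrite pu0 pv0 ps0 nor1_0 nor2_0 sqr0 !add0r.
Qed.

Lemma loclip_Kg : loclip p (fun z => Kg (pu z) (pv z) (ps z)).
Proof.
rewrite /Kg; apply: loclipM; first by loclip_tac.
by under eq_fun do rewrite invfM -exprVn; loclip_tac.
Qed.

Lemma loclip_Kn : loclip p (fun z => Kn (pu z) (pv z) (ps z)).
Proof.
rewrite /Kn; apply: loclipM; first by loclip_tac.
by under eq_fun do rewrite invfM -exprVn; loclip_tac.
Qed.

Lemma loclip_eq_u : loclip p (fun z => eq_u (pu z) (pv z ^+ 2) (ps z)).
Proof. exact: lip_eq_u. Qed.

Lemma loclip_eq_w : loclip p (fun z => eq_w (pu z) (pv z ^+ 2) (ps z)).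
Proof. exact: lip_eq_w. Qed.

End LipschitzAtOrigin.

(** At [v = 0] the slope is nonzero, so its sign [sigma] is constant nearby; the factor [Num.sg v]
    then separates the two sides. Continuity is required at the start of the curve, which need not
    be the origin. *)
Lemma curve_limits (U : R -> R) (s eta : R) :
  0 < eta -> smooth_on_sym U eta ->
  (forall v, - eta < v < eta ->
     c1 (U v) s + v ^+ 2 * c3 (U v) (v ^+ 2) s = 0) ->
  pd2 c1 (U 0) s != 0 -> eq_w (U 0) 0 s != 0 ->
  let z0 : R * R * R := (U 0, 0, s) in
  {for z0, continuous (fun z : R * R * R => eq_u z.1.1 (z.1.2 ^+ 2) z.2)} ->
  {for z0, continuous (fun z : R * R * R => eq_w z.1.1 (z.1.2 ^+ 2) z.2)} ->
  {for z0, continuous (fun z : R * R * R => Kg z.1.1 z.1.2 z.2)} ->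
  {for z0, continuous (fun z : R * R * R => Kn z.1.1 z.1.2 z.2)} ->
  exists2 sigma : R, sigma = 1 \/ sigma = -1 &
    [/\ kappa_g F U s v @[v --> 0^'+] --> sigma * Kg (U 0) 0 s,
        kappa_g F U s v @[v --> 0^'-] --> - sigma * Kg (U 0) 0 s &
        kappa_n F U s v @[v --> 0^'] --> Kn (U 0) 0 s].
Proof.
move=> eta0 sU eqU cu0 cw0 z0 ceq_u ceq_w cKg cKn.
have eqU' (y : R) : `|y| < eta -> c1 (U y) s + y ^+ 2 * c3 (U y) (y ^+ 2) s = 0.
  by rewrite ltr_norml => /eqU.
have dU (y : R) : `|y| < eta -> derivable U y 1.
  by rewrite ltr_norml => /(sU 0).
have dU1 (y : R) : `|y| < eta -> derivable (derive1 U) y 1.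
  by rewrite ltr_norml => /(sU 1).
have cU : {for (0 : R), continuous U}.
  by apply/differentiable_continuous/derivable1_diffP/dU; rewrite normr0.
pose gam (v : R) : R * R * R := (U v, v, s).
have cgam : gam v @[v --> (0 : R)] --> z0.
  have h1 : v @[v --> (0 : R)] --> (0 : R) by exact: cvg_id.
  have h2 : (fun=> s) @ (0 : R) --> s by exact: cvg_cst.
  exact: cvg_pair (cvg_pair cU h1) h2.
have along (G : R * R * R -> R) : {for z0, continuous G} ->
    G (gam v) @[v --> (0 : R)] --> G z0.
  by move=> cG; exact: cvg_comp cgam cG.
have cu : eq_u (U v) (v ^+ 2) s @[v --> (0 : R)] --> pd2 c1 (U 0) s.
  by have := along _ ceq_u; rewrite /= expr0n /= {2}/eq_u mul0r addr0.
have cw : eq_w (U v) (v ^+ 2) s @[v --> (0 : R)] --> eq_w (U 0) 0 s.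
  by have := along _ ceq_w; rewrite /= expr0n.
have csl : slope (U v) (v ^+ 2) s @[v --> (0 : R)] -->
    - pd2 c1 (U 0) s / eq_w (U 0) 0 s.
  by apply: cvgM; [exact: cvgN|exact: cvgV].
set sl := (X in _ --> X) in csl.
have sl0 : sl != 0 by rewrite mulf_neq0 ?oppr_eq0 ?invr_eq0.
have near_sg : \forall v \near (0 : R), Num.sg (slope (U v) (v ^+ 2) s) = Num.sg sl.
  have [sln|slp|/eqP] := ltgtP sl 0; last by rewrite (negbTE sl0).
  - near=> v; rewrite !ltr0_sg//; near: v; exact: (cvgr_lt sl csl).
  - near=> v; rewrite !gtr0_sg//; near: v; exact: (cvgr_gt sl csl).
have n1 : \forall v \near (0 : R), `|v| < eta.
  by apply/nbhs_ballP; exists eta => // v; rewrite -ball_normE /= sub0r normrN.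
have n2 : \forall v \near (0 : R), eq_u (U v) (v ^+ 2) s != 0.
  exact: (cvgr_neq0 _ cu).
have n3 : \forall v \near (0 : R), eq_w (U v) (v ^+ 2) s != 0.
  exact: (cvgr_neq0 _ cw).
have : \forall v \near (0 : R),
    (`|v| < eta /\ eq_u (U v) (v ^+ 2) s != 0) /\
    (eq_w (U v) (v ^+ 2) s != 0 /\
     Num.sg (slope (U v) (v ^+ 2) s) = Num.sg sl).
  exact: filterI (filterI n1 n2) (filterI n3 near_sg).
(* [eps] is a radius on which all hypotheses of [kappa_gE] and [kappa_nE] hold and the sign of the
   slope is constant. *)
move=> /nbhs_ballP[eps /= eps0 epsP].
have inball (y : R) : `|y| < eps -> ball (0 : R) eps y.
  by move=> ye; rewrite -ball_normE /= sub0r normrN.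
have e1 (y : R) (ye : `|y| < eps) : `|y| < eta := (epsP y (inball y ye)).1.1.
have e2 (y : R) (ye : `|y| < eps) : eq_u (U y) (y ^+ 2) s != 0 :=
  (epsP y (inball y ye)).1.2.
have e3 (y : R) (ye : `|y| < eps) : eq_w (U y) (y ^+ 2) s != 0 :=
  (epsP y (inball y ye)).2.1.
have h1 (y : R) (ye : `|y| < eps) := dU y (e1 y ye).
have h2 (y : R) (ye : `|y| < eps) := dU1 y (e1 y ye).
have h3 (y : R) (ye : `|y| < eps) := eqU' y (e1 y ye).
have kg (v : R) : 0 < `|v| < eps ->
    kappa_g F U s v = Num.sg v * Num.sg sl * Kg (U v) v s.
  move=> ve; have /andP[_ /inball/epsP[_ [_ <-]]] := ve.
  exact: (kappa_gE h1 h2 h3 e2 e3 ve).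
have kn (v : R) (ve : 0 < `|v| < eps) : kappa_n F U s v = Kn (U v) v s :=
  kappa_nE h1 h2 h3 e3 ve.
have cg : Kg (U v) v s @[v --> (0 : R)] --> Kg (U 0) 0 s := along _ cKg.
have cn : Kn (U v) v s @[v --> (0 : R)] --> Kn (U 0) 0 s := along _ cKn.
exists (Num.sg sl).
  have [sln|slp|/eqP] := ltgtP sl 0; last by rewrite (negbTE sl0).
  - by right; rewrite ltr0_sg.
  - by left; rewrite gtr0_sg.
split.
- apply: (@cvg_trans _ ((fun v => Num.sg sl * Kg (U v) v s) @ 0^'+)).
    apply: near_eq_cvg; near=> v.
    have v0 : 0 < v by near: v; exact: nbhs_right_gt.
    have ve : v < eps by near: v; exact: nbhs_right_lt.
    have vv : 0 < `|v| < eps by rewrite (gtr0_norm v0) v0.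
    by rewrite (kg v vv) (gtr0_sg v0) mul1r.
  apply: cvgM; [exact: cvg_cst|exact: cvg_at_right_filter].
- apply: (@cvg_trans _ ((fun v => - Num.sg sl * Kg (U v) v s) @ 0^'-)).
    apply: near_eq_cvg; near=> v.
    have v0 : v < 0 by near: v; exact: nbhs_left_lt.
    have ve : - eps < v by near: v; apply: nbhs_left_gt; rewrite oppr_lt0.
    have vv : 0 < `|v| < eps by rewrite (ltr0_norm v0) oppr_gt0 v0 /= ltrNl.
    by rewrite (kg v vv) (ltr0_sg v0) mulN1r.
  apply: cvgM; [exact: cvg_cst|exact: cvg_at_left_filter].
- apply: (@cvg_trans _ ((fun v => Kn (U v) v s) @ 0^')).
    apply: near_eq_cvg; near=> v.
    have v0 : v != 0 by near: v; exact: nbhs_dnbhs_neq.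
    have ve : `|v| < eps by near: v; exact: dnbhs0_lt.
    have vv : 0 < `|v| < eps by rewrite normr_gt0 v0.
    by rewrite (kn v vv).
  exact: cvg_within_filter.
Unshelve. all: by end_near. Qed.

End Surface.

(** * Rates of convergence and the derivative of [c1] *)

Section Coordinates.
Set Implicit Arguments. Unset Strict Implicit.
Variable R : realType.
Let p : R * R * R := 0.

Lemma loclip_fst1 : loclip p (fun z => z.1.1).
Proof.
exists 1; near=> d => x y _ _; rewrite mul1r.
by rewrite [leRHS]prod_normE le_max prod_normE le_max lexx.
Unshelve. all: by end_near. Qed.

Lemma loclip_snd1 : loclip p (fun z => z.1.2).
Proof.
exists 1; near=> d => x y _ _; rewrite mul1r.
by rewrite [leRHS]prod_normE le_max prod_normE le_max lexx orbT.
Unshelve. all: by end_near. Qed.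

Lemma loclip_snd : loclip p (fun z => z.2).
Proof.
exists 1; near=> d => x y _ _; rewrite mul1r.
by rewrite [leRHS]prod_normE le_max lexx orbT.
Unshelve. all: by end_near. Qed.

Lemma dnbhs0_ex (P : set R) : nbhs (0 : R)^' P ->
  exists2 d, 0 < d & forall t, 0 < `|t| < d -> P t.
Proof.
move=> [d /= d0 dP]; exists d => // t /andP[t0 td]; apply: dP => /=.
  by rewrite sub0r normrN.
by rewrite -normr_gt0.
Qed.

(** Source of the error terms: a Lipschitz function evaluated at a point within O(t) of [q] differs
    from its value at [q] by O(t). *)
Lemma loclip_rate (V : normedModType R) (q : V) (G : V -> R) (X : R -> V) (B : R) :
  loclip q G -> (\forall t \near 0^', `|X t - q| <= B * `|t|) ->
  X t @[t --> 0^'] --> q ->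
  exists C : R, \forall t \near 0^', `|G (X t) - G q| <= C * `|t|.
Proof.
move=> /loclip_pos[C C0 CG] XB Xq; exists (C * B).
have [d d0 Cd] : exists2 d, 0 < d & forall x y, ball q d x -> ball q d y ->
    `|G x - G y| <= C * `|x - y|.
  near (0 : R)^'+ => d; exists d; last by near: d.
  by near: d; exact: nbhs_right_gt.
near=> t; apply: (@le_trans _ _ (C * `|X t - q|)).
  apply: Cd; last exact: ballxx.
  by near: t; apply: Xq; exact: nbhsx_ballx.
rewrite -mulrA ler_wpM2l//.
by near: t.
Unshelve. all: by end_near. Qed.

(** Both sides are derivatives of the same function of [u]. The factors [s] and [u] are displayed so
    that [t] can be pulled out when [s] is [- t ^+ 2] and [u] is of order [t]. *)
Lemma pd2_c1 (c1 : R -> R -> R) (d1 d2 d3 : R -> R) (d4 : R -> R -> R) (u s : R) :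
  smooth2 c1 -> smooth2 d4 ->
  (forall u s, c1 u s = s + u * s * d1 s + u ^+ 2 * d2 s + u ^+ 3 * d3 s
                        + u ^+ 4 * d4 u s) ->
  pd2 c1 u s = s * d1 s + u * (2 * d2 s + 3 * u * d3 s + 4 * u ^+ 2 * d4 u s
                               + u ^+ 3 * pd2 d4 u s).
Proof.
move=> sc1 sd4 E.
have di : dalong u 1 (fun x : R => x) 1.
  by rewrite /dalong mulr1; exact: is_derive_id.
have h1 : dalong u 1 (fun x => c1 x s) (pd2 c1 u s).
  by apply: dalongE; [dalong_tac|rewrite mul1r].
have h2 : dalong u 1 (fun x => c1 x s) (s * d1 s + u * (2 * d2 s + 3 * u * d3 s
    + 4 * u ^+ 2 * d4 u s + u ^+ 3 * pd2 d4 u s)).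
  rewrite (_ : (fun x => c1 x s) = fun x => s + x * s * d1 s + x ^+ 2 * d2 s
    + x ^+ 3 * d3 s + x ^+ 4 * d4 x s); last by apply/funext => x.
  by apply: dalongE; [dalong_tac|abstract_atoms; ring].
have := @derive_val _ _ _ _ _ _ _ h1; rewrite (@derive_val _ _ _ _ _ _ _ h2).
by rewrite !mul1r.
Qed.

Lemma derive1_smooth2 (g : R -> R -> R) (s : R) : smooth2 g ->
  derive1 (fun u => g u s) = (fun u => pd2 g u s).
Proof.
move=> sg; apply/funext => u; rewrite derive1E; apply: derive_val.
have := smooth2_chain s sg (is_derive_id u 1); by rewrite mul1r.
Qed.

End Coordinates.

(** * The limiting curvatures up to O(t) *)

Theorem theorem4p2 (R : realType)
  (f21 f31 : R -> R) (f24 f34 c0 c1 : R -> R -> R) (c2 c3 : R -> R -> R -> R)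
  (d1 d2 d3 : R -> R) (d4 : R -> R -> R)
  (us : R -> R) (U : R -> R -> R) :
  smooth1 f21 -> smooth1 f31 -> smooth2 f24 -> smooth2 f34 ->
  smooth2 c0 -> smooth2 c1 -> smooth3 c2 -> smooth3 c3 ->
  smooth1 d1 -> smooth1 d2 -> smooth1 d3 -> smooth2 d4 ->
  c0 0 0 = 0 -> c3 0 0 0 != 0 ->
  (forall u s, c1 u s = s + u * s * d1 s + u ^+ 2 * d2 s + u ^+ 3 * d3 s
                        + u ^+ 4 * d4 u s) ->
  0 < d2 0 ->
  (* us t = u(t~): the root of c1(u, -t~^2) = 0 near 0 with u(t~) ~ t~/sqrt(d2(0)) *)
  (\forall t \near 0^', c1 (us t) (- t ^+ 2) = 0) ->
  (fun t => us t / t) @ 0^' --> (Num.sqrt (d2 0))^-1 ->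
  (* U t = v |-> u(v, -t~^2): smooth solution of c1(u,s) + v^2 c3(u,v^2,s) = 0
     near v = 0 with u(0,s) = u(t~) *)
  (\forall t \near 0^', exists2 eta : R, 0 < eta &
      [/\ U t 0 = us t, smooth_on_sym (U t) eta &
          forall v, - eta < v < eta ->
            c1 (U t v) (- t ^+ 2) + v ^+ 2 * c3 (U t v) (v ^+ 2) (- t ^+ 2) = 0]) ->
  let F := surf_f f21 f31 f24 f34 c0 c1 c2 c3 in
  let A := (- 2 * f21 0 * c3 0 0 0 + derive1 (derive1 (fun u => c1 u 0)) 0)
             / c3 0 0 0 in
  exists C delta : R, 0 < delta /\
    forall t : R, 0 < `|t| < delta ->
      exists eps : R, (eps = 1 \/ eps = -1) /\
      exists Lgp Lgm Lnp Lnm : R,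
        [/\ kappa_g F (U t) (- t ^+ 2) v @[v --> 0^'+] --> Lgp,
            kappa_g F (U t) (- t ^+ 2) v @[v --> 0^'-] --> Lgm,
            kappa_n F (U t) (- t ^+ 2) v @[v --> 0^'+] --> Lnp,
            kappa_n F (U t) (- t ^+ 2) v @[v --> 0^'-] --> Lnm &
        [/\ `|Lgp - eps * A| <= C * `|t|,
            `|Lgm + eps * A| <= C * `|t|,
            `|Lnp - 2 * f31 0| <= C * `|t| &
            `|Lnm - 2 * f31 0| <= C * `|t| ]].
Proof.
move=> sf21 sf31 sf24 sf34 sc0 sc1 sc2 sc3 sd1 sd2 sd3 sd4 c00 c30 c1E d20.
move=> _ us_t U_t F A.
pose k := (Num.sqrt (d2 0))^-1.
have k0 : 0 < k by rewrite invr_gt0 sqrtr_gt0.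
have c1u u s := pd2_c1 u s sc1 sd4 c1E.
have c1u0 : pd2 c1 0 0 = 0 by rewrite c1u !mul0r addr0.
pose p : R * R * R := 0.
pose X (t : R) : R * R * R := (us t, 0, - t ^+ 2).
have ct : t @[t --> (0 : R)^'] --> (0 : R) by exact: nbhs_dnbhs.
have cus : us t @[t --> (0 : R)^'] --> (0 : R).
  have : us t / t * t @[t --> (0 : R)^'] --> k * 0 by exact: cvgM us_t ct.
  rewrite mulr0; apply: cvg_trans; apply: near_eq_cvg; near=> t.
  by rewrite divfK//; near: t; exact: nbhs_dnbhs_neq.
have cs : - t ^+ 2 @[t --> (0 : R)^'] --> (0 : R).
  have h : - (t * t) @[t --> (0 : R)^'] --> - (0 * 0 : R).
    by apply: cvgN; exact: (cvgM ct ct).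
  by rewrite mulr0 oppr0 in h; exact: h.
have cX : X t @[t --> 0^'] --> p.
  have h : (fun=> 0) @ (0 : R)^' --> (0 : R) by exact: cvg_cst.
  exact: cvg_pair (cvg_pair cus h) cs.
(* For small [t] the ratio [us t / t] is within 1 of its limit [k], which gives the constant
   [k + 1]; it also covers the last coordinate, as [t ^+ 2] is at most [|t|] when [|t| < 1]. *)
have XB : \forall t \near 0^', `|X t - p| <= (k + 1) * `|t|.
  near=> t.
  have t1 : `|t| < 1 by near: t; exact: dnbhs0_lt.
  have t0 : t != 0 by near: t; exact: nbhs_dnbhs_neq.
  have ut : `|us t| <= (k + 1) * `|t|.
    have : `|k - us t / t| <= 1.
      by near: t; move/cvgrPdist_le : us_t; apply.
    rewrite -ler_pdivrMr ?normr_gt0// -normf_div.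
    have := ler_normD k (us t / t - k); rewrite subrKC (gtr0_norm k0) distrC; lra.
  rewrite subr0 prod_normE /= prod_normE /= !ge_max ut normr0 normrN normrX /=.
  rewrite mulr_ge0 ?addr_ge0 ?(ltW k0)//= expr2 ler_wpM2r//.
  by rewrite (le_trans (ltW t1))// lerDr ltW.
have lu := @loclip_fst1 R; have lv := @loclip_snd1 R; have ls := @loclip_snd R.
pose KG (z : R * R * R) := Kg f21 f31 f24 f34 c0 c1 c2 c3 z.1.1 z.1.2 z.2.
pose KN (z : R * R * R) := Kn f21 f31 f24 f34 c0 c1 c2 c3 z.1.1 z.1.2 z.2.
have lKg : loclip p KG := loclip_Kg sf21 sf31 sf24 sf34 sc0 sc1 sc2 sc3
  lu lv ls erefl erefl erefl c30 c00 c1u0.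
have lKn : loclip p KN := loclip_Kn sf21 sf31 sf24 sf34 sc0 sc1 sc2 sc3
  lu lv ls erefl erefl erefl c30 c00 c1u0.
have lequ := loclip_eq_u sc1 sc3 lu lv ls.
have leqw := loclip_eq_w sc3 lu lv ls.
have near_cont (G : R * R * R -> R) : loclip p G ->
    \forall t \near 0^', {for X t, continuous G}.
  by move=> /loclip_continuous; exact: cX.
have nKg := near_cont _ lKg; have nKn := near_cont _ lKn.
have nequ := near_cont _ lequ; have neqw := near_cont _ leqw.
have [C1 HC1] := loclip_rate lKg XB cX.
have [C2 HC2] := loclip_rate lKn XB cX.
have eqw0 : \forall t \near 0^', eq_w c3 (us t) 0 (- t ^+ 2) != 0.
  have : eq_w c3 (us t) (0 ^+ 2) (- t ^+ 2) @[t --> 0^'] --> eq_w c3 0 (0 ^+ 2) 0.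
    exact: cvg_comp cX (loclip_continuous_at leqw).
  by rewrite expr0n => /cvgr_neq0; apply; rewrite /eq_w mul0r addr0.
(* Divided by [t], this derivative tends to twice the square root of [d2 0], which is positive. Its
   nonvanishing makes the slope at [v = 0] nonzero, so that U' changes sign there. *)
have c1u_neq0 : \forall t \near 0^', pd2 c1 (us t) (- t ^+ 2) != 0.
  have lG : loclip p (fun z : R * R * R => 2 * d2 z.2 + 3 * z.1.1 * d3 z.2
      + 4 * z.1.1 ^+ 2 * d4 z.1.1 z.2 + z.1.1 ^+ 3 * pd2 d4 z.1.1 z.2).
    have sd5 := smooth2_pd sd4.
    apply: loclipD; [apply: loclipD; [apply: loclipD|]|].
    - exact: loclipM (loclip_cst _ _) (loclip_smooth1 sd2 ls).
    - exact: loclipM (loclipM (loclip_cst _ _) lu) (loclip_smooth1 sd3 ls).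
    - exact: loclipM (loclipM (loclip_cst _ _) (loclipX _ lu))
        (loclip_smooth2 sd4 lu ls).
    - exact: loclipM (loclipX _ lu) (loclip_smooth2 sd5 lu ls).
  have cd1 : d1 (- t ^+ 2) @[t --> 0^'] --> d1 0.
    exact: cvg_comp cX (loclip_continuous_at (loclip_smooth1 sd1 ls)).
  have cH : - t * d1 (- t ^+ 2) + us t / t *
      (2 * d2 (- t ^+ 2) + 3 * us t * d3 (- t ^+ 2)
       + 4 * us t ^+ 2 * d4 (us t) (- t ^+ 2)
       + us t ^+ 3 * pd2 d4 (us t) (- t ^+ 2)) @[t --> 0^'] -->
      - 0 * d1 0 + (Num.sqrt (d2 0))^-1 * (2 * d2 0 + 3 * 0 * d3 0
      + 4 * 0 ^+ 2 * d4 0 0 + 0 ^+ 3 * pd2 d4 0 0).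
    apply: cvgD; apply: cvgM.
    - exact: cvgN.
    - exact: cd1.
    - exact: us_t.
    - exact: cvg_comp cX (loclip_continuous_at lG).
  have H0 : - 0 * d1 0 + (Num.sqrt (d2 0))^-1 * (2 * d2 0 + 3 * 0 * d3 0
      + 4 * 0 ^+ 2 * d4 0 0 + 0 ^+ 3 * pd2 d4 0 0) != 0.
    rewrite !expr0n /= !(mulr0, mul0r, oppr0, addr0, add0r).
    by rewrite !mulf_neq0 ?gt_eqF// ?invr_gt0 ?sqrtr_gt0.
  have nH := cvgr_neq0 _ cH H0.
  near=> t.
  have t0 : t != 0 by near: t; exact: nbhs_dnbhs_neq.
  have -> : pd2 c1 (us t) (- t ^+ 2) = t * (- t * d1 (- t ^+ 2) + us t / t *
     (2 * d2 (- t ^+ 2) + 3 * us t * d3 (- t ^+ 2)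
      + 4 * us t ^+ 2 * d4 (us t) (- t ^+ 2)
      + us t ^+ 3 * pd2 d4 (us t) (- t ^+ 2))).
    by rewrite c1u; abstract_atoms; field.
  by rewrite mulf_neq0//; near: t; exact: nH.
have [delta delta0 dP] := dnbhs0_ex
  (filterI (filterI (filterI nKg nKn) (filterI nequ neqw))
    (filterI (filterI HC1 HC2) (filterI (filterI eqw0 c1u_neq0) U_t))).
(* [A] has the sign opposite to the value of [Kg] at the origin; this is why [eps] is chosen below
   as [- sigma]. *)
have AE : A = - KG p.
  rewrite /KG (Kg_0 f21 f31 f24 f34 c2 c30 c00 c1u0) /A derive1_smooth2//.
  rewrite derive1_smooth2; last exact: smooth2_pd.
  by move: (pd2 _ _ _) => b; field.
have BE : 2 * f31 0 = KN p by rewrite /KN (Kn_0 f21 f31 f24 f34 c2 c3 c00 c1u0).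
exists (Num.max C1 C2), delta; split=> // t tdelta.
have m1 : C1 * `|t| <= Num.max C1 C2 * `|t|.
  by apply: ler_wpM2r => //; rewrite le_max lexx.
have m2 : C2 * `|t| <= Num.max C1 C2 * `|t|.
  by apply: ler_wpM2r => //; rewrite le_max lexx orbT.
have [[[nKgt nKnt] [nequt neqwt]] [[HC1t HC2t] [[w0 u0] [eta eta0 [U0 sU eqU]]]]] :=
  dP t tdelta.
rewrite /X -U0 in nKgt nKnt nequt neqwt.
rewrite -U0 in w0 u0.
have [sigma sigma1 [cgp cgm cn]] := curve_limits sf21 sf31 sf24 sf34 sc0 sc1 sc2 sc3
  eta0 sU eqU u0 w0 nequt neqwt nKgt nKnt.
have nsigma : `|sigma| = 1 by case: sigma1 => ->; rewrite ?normrN normr1.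
exists (- sigma); split.
  by case: sigma1 => ->; [right|left; rewrite opprK].
have KX : Kg f21 f31 f24 f34 c0 c1 c2 c3 (U t 0) 0 (- t ^+ 2) = KG (X t).
  by rewrite U0.
have KY : Kn f21 f31 f24 f34 c0 c1 c2 c3 (U t 0) 0 (- t ^+ 2) = KN (X t).
  by rewrite U0.
rewrite KX in cgp cgm; rewrite KY in cn.
exists (sigma * KG (X t)), (- sigma * KG (X t)), (KN (X t)), (KN (X t)).
split.
- exact: cgp.
- exact: cgm.
- exact: cvg_dnbhs_at_right cn.
- exact: cvg_dnbhs_at_left cn.
rewrite AE BE; split.
- by rewrite mulrNN -mulrBr normrM nsigma mul1r (le_trans HC1t).
- by rewrite mulrNN mulNr addrC -mulrBr normrM nsigma mul1r distrC (le_trans HC1t).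
- exact: le_trans HC2t m2.
- exact: le_trans HC2t m2.
Unshelve. all: by end_near. Qed.
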